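(* Let $m\ge 2$ be an integer, $K$ a field, and let $G=C_n(1,\ldots,r)$, with $1\le r\le \lfloor n/2\rfloor$, be a power cycle on $n$ vertices that is not a complete graph. Then the generalized binomial edge ideal $J_{G,m}$ is unmixed if and only if $m$ is odd, $n\in\{m+1,\ldots,\frac{3m+1}{2}\}$ and $r=\frac{m-1}{2}$.
   Context: Power cycle: for integers $1\le r\le\lfloor n/2\rfloor$, $C_n(1,\ldots,r)$ is the graph with vertex set $\mathbb{Z}_n=\{0,\dots,n-1\}$ in which $i\neq j$ are adjacent if and only if $|j-i|_n\in\{1,\dots,r\}$, where $|k|_n=\min\{|k|,n-|k|\}$ is the circular distance modulo $n$. Generalized binomial edge ideal: for integers $m,n\ge 2$, a field $K$ and a finite simple graph $G$ with $n$ vertices (labelled as the columns of the matrix), let $X=(x_{ij})$ be an $m\times n$ matrix of indeterminates and $R=K[X]$. The ideal $J_{G,m}\subset R$ is generated by all the $2$-minors $x_{ki}x_{\ell j}-x_{kj}x_{\ell i}$ with $1\le k<\ell\le m$ and $\{i,j\}$ an edge of $G$. An ideal is unmixed if all its associated primes have the same height. *)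

(* Defs.v *)
From mathcomp Require Import all_boot all_order all_algebra.
From mathcomp Require Import boolp classical_sets.
From mathcomp Require Import mpoly.

Set Implicit Arguments.
Unset Strict Implicit.
Unset Printing Implicit Defensive.

Import GRing.Theory.
Local Open Scope ring_scope.
Local Open Scope classical_set_scope.

Section CommutativeAlgebra.
Variable R : comNzRingType.
Implicit Types (A I P : set R).

(* The empty combination gives 0; the result may be the unit ideal. *)
Definition ideal_generated A : set R :=
  [set x | exists2 s : seq (R * R),
     (forall p, p \in s -> A p.2) & x = \sum_(p <- s) p.1 * p.2].

(* [idealr_closed] already requires the ideal to be proper. *)
Definition prime_ideal P : Prop :=
  idealr_closed (mem P) /\ prime_idealr_closed (mem P).

Definition associated_prime I P : Prop :=
  prime_ideal P /\ exists f, P = [set a | I (a * f)].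

(* A strict chain c 0 < c 1 < ... < c h = P of prime ideals. *)
Definition prime_chain_below P (h : nat) : Prop :=
  exists c : nat -> set R,
    [/\ forall i, (i <= h)%N -> prime_ideal (c i),
        forall i, (i < h)%N -> c i `<` c i.+1
      & c h = P].

Definition has_height P (h : nat) : Prop :=
  prime_chain_below P h /\
  forall k, prime_chain_below P k -> (k <= h)%N.

(* The common height is required to be finite, which is automatic when R is
   Noetherian. *)
Definition unmixed I : Prop :=
  exists h, forall P, associated_prime I P -> has_height P h.

End CommutativeAlgebra.

Definition circular_dist (n i j : nat) : nat :=
  let d := maxn (i - j) (j - i) in minn d (n - d).

Definition power_cycle (n r : nat) : rel 'I_n :=
  fun i j => (i != j) && (1 <= circular_dist n i j <= r)%N.

Arguments power_cycle : clear implicits.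

Lemma power_cycle_sym n r : ssrbool.symmetric (power_cycle n r).
Proof.
by move=> i j; rewrite /power_cycle /circular_dist eq_sym maxnC.
Qed.

Lemma power_cycle_irrefl n r : irreflexive (power_cycle n r).
Proof. by move=> i; rewrite /power_cycle eqxx. Qed.

Definition complete_graph (T : eqType) (e : rel T) : Prop :=
  forall i j, i != j -> e i j.

Section GeneralizedBinomialEdgeIdeal.
Variables (K : fieldType) (m n : nat).

(* K[X] has m * n variables, x_ij being the one of index mxvec_index i j. *)
Definition generic_mx : 'M[{mpoly K[m * n]}]_(m, n) :=
  \matrix_(i, j) 'X_(mxvec_index i j).

Local Notation x := generic_mx.

Definition binomial_edge_ideal (e : rel 'I_n) : set {mpoly K[m * n]} :=
  ideal_generated
    [set f | exists k l : 'I_m, exists i j : 'I_n,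
       [/\ (k < l)%N, e i j & f = x k i * x l j - x k j * x l i]].

End GeneralizedBinomialEdgeIdeal.

Arguments binomial_edge_ideal K m {n} e.

(* Main.v *)
(* For a set S of vertices of a graph G, let P_S be generated by the variables of
   the columns in S and the 2-minors of the components of G - S. It is the kernel
   of a monomial parametrization, hence prime, and a chain of such kernels on one
   side and transcendence degree on the other give it the height
   m |S| + (m - 1) (n - |S| - c(S)), with c(S) the number of components.
   For a vertex v, J_G is the intersection of the ideal of G with the neighbours
   of v made adjacent and of the ideal of G - v plus the variables of v; by
   induction J_G is the intersection of all P_S. So its associated primes are the
   P_S for which every vertex of S joins two components of G - S.
   In a non-complete power cycle such a nonempty S consists of c(S) >= 2 blocks of
   exactly r consecutive vertices. Comparing heights for S empty and for two
   blocks gives 2r = m - 1; three blocks then break equality, and they exist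
   exactly when n >= 3r + 3. *)

From HB Require Import structures.
Require Import Defs.
From mathcomp Require Import all_boot all_order all_algebra.
From mathcomp Require Import boolp classical_sets mpoly.
From mathcomp Require Import zify ring.

Set Implicit Arguments.
Unset Strict Implicit.
Unset Printing Implicit Defensive.

(** * Prime ideals as kernels, and uniqueness of the height *)

Section KernelPrimes.
Import GRing.Theory.
Local Open Scope ring_scope.
Local Open Scope classical_set_scope.

Lemma prime_kernel (R : comNzRingType) (D : idomainType) (f : {rmorphism R -> D}) :
  prime_ideal [set x | f x = 0].
Proof.
split.
  split.
  - by rewrite in_setE /= rmorph0.
  - by rewrite notin_setE /= rmorph1; apply/eqP; rewrite oner_eq0.
  - move=> a u v; rewrite !in_setE /= => fu fv.
    by rewrite rmorphD rmorphM fu fv mulr0 addr0.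
move=> u v; rewrite !in_setE /= rmorphM => /eqP; rewrite mulf_eq0.
by case/orP => /eqP e; apply/orP; [left|right]; rewrite in_setE.
Qed.

Lemma prime_ideal0 (R : comNzRingType) (P : set R) : prime_ideal P -> P 0.
Proof. by case=> -[+ _ _] _; rewrite in_setE. Qed.

Lemma prime_idealN1 (R : comNzRingType) (P : set R) : prime_ideal P -> ~ P 1.
Proof. by case=> -[_ + _] _; rewrite notin_setE. Qed.

Lemma prime_idealD (R : comNzRingType) (P : set R) x y :
  prime_ideal P -> P x -> P y -> P (x + y).
Proof.
case=> -[_ _ h] _ px py; have := h 1 x y; rewrite !in_setE mul1r.
exact.
Qed.

Lemma prime_idealMl (R : comNzRingType) (P : set R) a x :
  prime_ideal P -> P x -> P (a * x).
Proof.
case=> -[h0 _ h] _ px; have := h a x 0; rewrite !in_setE addr0.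
by rewrite in_setE in h0; exact.
Qed.

Lemma prime_idealM (R : comNzRingType) (P : set R) x y :
  prime_ideal P -> P (x * y) -> P x \/ P y.
Proof.
case=> _ h pxy; have := h x y; rewrite !in_setE => /(_ pxy) /orP.
by rewrite !in_setE.
Qed.

Lemma has_height_uniq (R : comNzRingType) (P : set R) h1 h2 :
  has_height P h1 -> has_height P h2 -> h1 = h2.
Proof. by case=> c1 l1 [c2 l2]; apply/eqP; rewrite eqn_leq l2 ?l1. Qed.

End KernelPrimes.

(** * Bounding chains of primes by transcendence degree *)

Section AlgebraicIndependence.
Import GRing.Theory.
Local Open Scope ring_scope.
Local Open Scope classical_set_scope.
Variables (K : fieldType).

Lemma mpoly_hom_eq N (S : comNzRingType) (f1 f2 : {rmorphism {mpoly K[N]} -> S}) :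
  (forall c, f1 c%:MP = f2 c%:MP) -> (forall i, f1 'X_i = f2 'X_i) -> f1 =1 f2.
Proof.
move=> hC hX p; rewrite [p]mpolyE !rmorph_sum; apply: eq_bigr => m _.
rewrite -mul_mpolyC !rmorphM /= hC; congr (_ * _).
rewrite mpolyXE_id !rmorph_prod; apply: eq_bigr => i _.
by rewrite !rmorphXn /= hX.
Qed.

(** Algebraic independence of the classes of the [F i] in the quotient by [P]: the transcendence
    degree of the quotient is at least [d]. *)
Definition indep_mod N d (P : set {mpoly K[N]}) :=
  exists F : 'I_d -> {mpoly K[N]},
    forall g : {mpoly K[d]}, P (mmap (@mpolyC N K) F g) -> g = 0.

(** An element [a] of [Q] outside [P] can be joined to a family independent modulo [Q]: in a
    relation modulo [P], the constant term in [a] lies in [Q], so it vanishes; since [P] is prime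
    and misses [a], the relation can be divided by [a], and induction on the degree applies. *)
Lemma indep_mod_step N d (P Q : set {mpoly K[N]}) :
  prime_ideal P -> prime_ideal Q -> P `<` Q ->
  indep_mod d Q -> indep_mod d.+1 P.
Proof.
move=> pP pQ [PQ nQP] [F hF].
have [a Qa nPa] : exists2 a, Q a & ~ P a.
  apply: contrapT => h; apply: nQP => x Qx; apply: contrapT => nPx.
  by apply: h; exists x.
pose ev : {rmorphism {mpoly K[d]} -> {mpoly K[N]}} := mmap (@mpolyC N K) F.
have cev : commr_rmorph ev a by move=> x; exact: mulrC.
pose E : {rmorphism {poly {mpoly K[d]}} -> {mpoly K[N]}} := horner_morph cev.
have hE q : P (E q) -> q = 0.
  elim/poly_ind: q => [//|q c IH].
  rewrite rmorphD rmorphM /= horner_morphX horner_morphC => h.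
  have c0 : c = 0.
    apply: hF.
    have -> : mmap (mpolyC N (R:=K)) F c = (E q * a + ev c) + (- E q) * a.
      by rewrite mulNr addrAC subrr add0r.
    by apply: (prime_idealD pQ); [exact: PQ | exact: prime_idealMl].
  move: h; rewrite c0 rmorph0 addr0 => /(prime_idealM pP) [/IH ->|//].
  by rewrite mul0r add0r.
pose G i := oapp F a (unlift ord_max i); exists G => g.
(* [W] reads the last variable as a polynomial variable over the other [d]; [V] below undoes it. *)
pose W : {rmorphism {mpoly K[d.+1]} -> {poly {mpoly K[d]}}} :=
  mmap (polyC \o @mpolyC d K)
    (fun i => oapp (fun j => ('X_j : {mpoly K[d]})%:P) 'X (unlift ord_max i)).
have -> : mmap (mpolyC N (R:=K)) G g = E (W g).
  apply: (mpoly_hom_eq (f1 := mmap _ _) (f2 := E \o W)) => [c|i] /=.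
    by rewrite !mmapC /= horner_morphC /ev /= mmapC.
  rewrite !mmapX !mmap1U /G; case: unliftP => [j|] _ /=.
    by rewrite horner_morphC /ev /= mmapX mmap1U.
  by rewrite horner_morphX.
move=> /hE Wg.
pose V1 : {rmorphism {mpoly K[d]} -> {mpoly K[d.+1]}} :=
  mmap (@mpolyC d.+1 K) (fun j => 'X_(lift ord_max j)).
have cV : commr_rmorph V1 ('X_ord_max : {mpoly K[d.+1]}) by move=> x; exact: mulrC.
pose V : {rmorphism {poly {mpoly K[d]}} -> {mpoly K[d.+1]}} := horner_morph cV.
have : V (W g) = g.
  apply: (mpoly_hom_eq (f1 := V \o W) (f2 := idfun)) => [c|i] /=.
    by rewrite mmapC /= horner_morphC /V1 /= mmapC.
  rewrite mmapX mmap1U; case: unliftP => [j ->|->] /=.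
    by rewrite horner_morphC /V1 /= mmapX mmap1U.
  by rewrite horner_morphX.
by rewrite Wg rmorph0.
Qed.


Lemma msize_prod_exp_le N d (F : 'I_d -> {mpoly K[N]}) c D (a : 'I_d -> nat) :
  (forall k, msize (F k) <= c.+1)%N -> (forall k, a k <= D)%N ->
  (msize (\prod_k F k ^+ a k) <= (d * (D * c)).+1)%N.
Proof.
move=> Fc aD.
have mulB b b' (p q : {mpoly K[N]}) :
    (msize p <= b.+1 -> msize q <= b'.+1 -> msize (p * q) <= (b + b').+1)%N.
  have [->|p0] := eqVneq p 0; first by rewrite mul0r msize0.
  have [->|q0] := eqVneq q 0; first by rewrite mulr0 msize0.
  by move=> hp hq; rewrite msizeM // -subn1 leq_subLR add1n -addnS -addSn leq_add.
have -> : (d * (D * c) = \sum_(k < d) D * c)%N by rewrite sum_nat_const card_ord.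
elim/big_ind2: _ => [|b p b' q|k _]; first by rewrite msize1.
  by move=> ? ?; exact: mulB.
have : (msize (F k ^+ a k) <= (a k * c).+1)%N.
  elim: (a k) => [|e IH]; first by rewrite expr0 msize1.
  by rewrite exprS mulSn; exact: mulB.
by move=> /leq_trans; apply; rewrite ltnS leq_mul2r aD orbT.
Qed.

(** A counting argument: if [N < d], the [D ^ d] power products of the [F i] with exponents below
    [D] outnumber the [M ^ N] monomials that can occur in them, so some nontrivial linear
    combination is zero. *)
Lemma indep_mod_leq N d (P : set {mpoly K[N]}) :
  prime_ideal P -> indep_mod d P -> (d <= N)%N.
Proof.
move=> pP [F hF]; rewrite leqNgt; apply/negP => ltNd.
pose c := (\max_(i < d) msize (F i))%N.
(* This choice gives [M <= (d * c).+1 * D], hence [M ^ N < D * D ^ N <= D ^ d]. *)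
pose D := (((d * c).+1) ^ N).+1%N.
pose M := (d * (D * c)).+1%N.
have DM : (M ^ N < D ^ d)%N.
  have h1 : (M <= (d * c).+1 * D)%N by rewrite /M mulSn /D; lia.
  apply: (@leq_ltn_trans (((d * c).+1 * D) ^ N)%N).
    by case: (N) => // N'; rewrite leq_exp2r.
  apply: (@leq_trans (D ^ N.+1)%N); last by rewrite leq_pexp2l.
  by rewrite expnMn expnS ltn_pmul2r // expn_gt0.
pose mono n B (f : {ffun 'I_n -> 'I_B}) := [multinom (f k : nat) | k < n].
pose al n B (i : 'I_#|{ffun 'I_n -> 'I_B}|) : {ffun 'I_n -> 'I_B} := enum_val i.
pose A : 'M[K]_(#|{ffun 'I_d -> 'I_D}|, #|{ffun 'I_N -> 'I_M}|) :=
  \matrix_(i, j) (\prod_k F k ^+ (al _ _ i k))@_(mono _ _ (al _ _ j)).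
have [u u0 uA] : exists2 u : 'rV_ _, u != 0 & u *m A = 0.
  have /rowV0Pn[u /sub_kermxP uA u0] : kermx A != 0; last by exists u.
  rewrite -mxrank_eq0 mxrank_ker -lt0n subn_gt0.
  apply: leq_ltn_trans (rank_leq_col _) _.
  by rewrite !card_ffun !card_ord.
pose g : {mpoly K[d]} := \sum_i u 0 i *: 'X_[mono _ _ (al _ _ i)].
have gE i : g@_(mono _ _ (al _ _ i)) = u 0 i.
  rewrite raddf_sum (bigD1 i) //= mcoeffZ mcoeffX eqxx mulr1 big1 ?addr0 // => j ji.
  rewrite mcoeffZ mcoeffX; case: eqP => [/mnmP e|_]; last by rewrite mulr0.
  case/eqP: ji; apply: enum_val_inj; apply/ffunP => k; apply: val_inj.
  by have := e k; rewrite !mnmE.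
suff g0 : g = 0.
  case/eqP: u0; apply/rowP => i; rewrite mxE -gE g0 mcoeff0 //.
apply: hF; suff -> : mmap (mpolyC N (R:=K)) F g = 0 by exact: prime_ideal0.
have -> : mmap (mpolyC N (R:=K)) F g = \sum_i u 0 i *: \prod_k F k ^+ (al _ _ i k).
  rewrite rmorph_sum; apply: eq_bigr => i _ /=.
  rewrite mmapZ mmapX mul_mpolyC /mmap1; congr (_ *: _).
  by apply: eq_bigr => k _; rewrite mnmE.
apply/mpolyP => mu; rewrite mcoeff0 raddf_sum /=.
(* The columns of [A] are the monomials with all exponents below [M]; any other monomial has degree
   at least [M], too large for a power product. *)
have [small|big] := pselect (forall k, mu k < M)%N.
  pose f : {ffun 'I_N -> 'I_M} := [ffun k => Ordinal (small k)].
  have -> : mu = mono _ _ (al _ _ (enum_rank f)).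
    by apply/mnmP => k; rewrite mnmE /al enum_rankK ffunE.
  have := congr1 (fun v : 'rV_ _ => v 0 (enum_rank f)) uA.
  rewrite !mxE => e0; rewrite -{}[RHS]e0.
  by apply: eq_bigr => i _; rewrite mcoeffZ !mxE.
apply: big1 => i _; rewrite mcoeffZ memN_msupp_eq0 ?mulr0 //.
apply: msize_mdeg_ge; apply: (@leq_trans M).
  apply: msize_prod_exp_le => k; last by rewrite ltnW.
  by rewrite leqW // /c (leq_bigmax k).
rewrite leqNgt; apply/negP => lt; apply: big => k; apply: leq_ltn_trans lt.
by rewrite mdegE (bigD1 k) //= leq_addr.
Qed.

(** Each step down the chain gains one independent element, so the bottom of the chain has [h + d]
    of them. *)
Lemma prime_chain_leq N d h (P : set {mpoly K[N]}) :
  indep_mod d P -> prime_chain_below P h -> (h + d <= N)%N.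
Proof.
move=> + [c [pc sc ch]]; rewrite -ch => {}ch.
suff : forall k, (k <= h)%N -> indep_mod (k + d) (c (h - k)%N).
  move=> /(_ h (leqnn h)); rewrite subnn; apply: indep_mod_leq; exact: pc.
elim=> [|k IH] kh; first by rewrite subn0.
rewrite addSn; apply: indep_mod_step (IH (ltnW kh)).
- by apply: pc; exact: leq_subr.
- by apply: pc; exact: leq_subr.
- have -> : (h - k = (h - k.+1).+1)%N by lia.
  by apply: sc; lia.
Qed.
End AlgebraicIndependence.

(** * Chains of primes from substitutions of variables *)

Section SubstitutionChain.
Import GRing.Theory.
Local Open Scope ring_scope.
Local Open Scope classical_set_scope.
Variables (K : fieldType) (N : nat).
Local Notation R := {mpoly K[N]}.
Implicit Types (h k : 'I_N -> R) (D A : {set 'I_N}) (p q f : R).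

Definition subst h p : R := mmap (@mpolyC N K) h p.

HB.instance Definition _ h := GRing.RMorphism.copy (subst h) (mmap (@mpolyC N K) h).

Lemma subst0 h : subst h 0 = 0. Proof. exact: rmorph0. Qed.
Lemma subst1 h : subst h 1 = 1. Proof. exact: rmorph1. Qed.
Lemma substB h : {morph subst h : p q / p - q}. Proof. exact: rmorphB. Qed.
Lemma substD h : {morph subst h : p q / p + q}. Proof. exact: rmorphD. Qed.
Lemma substM h : {morph subst h : p q / p * q}. Proof. exact: rmorphM. Qed.

Lemma substC h c : subst h c%:MP = c%:MP.
Proof. exact: mmapC. Qed.

Lemma substX h i : subst h 'X_i = h i.
Proof. by rewrite /subst mmapX mmap1U. Qed.

Lemma eq_subst h k : h =1 k -> subst h =1 subst k.
Proof. by move=> e; apply: mpoly_hom_eq => [c|i] /=; [rewrite !substC | rewrite !substX e]. Qed.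

Lemma subst_id p : subst (fun i => 'X_i) p = p.
Proof.
move: p; apply: (mpoly_hom_eq (f2 := idfun)) => [c|i] /=; first by rewrite substC.
by rewrite substX.
Qed.

Lemma subst_comp h k p : subst k (subst h p) = subst (fun i => subst k (h i)) p.
Proof.
move: p; apply: (mpoly_hom_eq (f1 := subst k \o subst h)) => [c|i] /=.
  by rewrite !substC.
by rewrite !substX.
Qed.

Lemma mpolyX_neq0 mu : 'X_[mu] != 0 :> R.
Proof. by rewrite -msupp_eq0 msuppX. Qed.

(** Says that [p] involves no variable of [D], by way of evaluation: this form passes to products
    and substitutions without looking at supports. *)
Definition free_of D p :=
  forall h k, (forall b, b \notin D -> h b = k b) -> subst h p = subst k p.

Lemma free_ofM D p q : free_of D p -> free_of D q -> free_of D (p * q).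
Proof. by move=> hp hq h k hk; rewrite !substM (hp h k) ?(hq h k). Qed.

Lemma free_ofX D i : i \notin D -> free_of D 'X_i.
Proof. by move=> iD h k hk; rewrite !substX hk. Qed.

Lemma free_of0 D : free_of D 0.
Proof. by move=> h k hk; rewrite !subst0. Qed.

Lemma free_of1 D : free_of D 1.
Proof. by move=> h k hk; rewrite !subst1. Qed.

Lemma free_of_subst D h p : (forall b, free_of D (h b)) -> free_of D (subst h p).
Proof. by move=> hh k k' e; rewrite !subst_comp; apply: eq_subst => b; exact: hh. Qed.

(* The chain substitutes the variables of D one at a time; the elements
   'X_a * p - q witness that the inclusions are strict. *)
Lemma subst_prime_chain h D :
  (forall b, free_of D (h b)) ->
  (forall a, a \in D -> exists p q, [/\ free_of D p, free_of D q,
     subst h p != 0 & subst h ('X_a * p) = subst h q]) ->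
  prime_chain_below [set f | subst h f = 0] #|D|.
Proof.
move=> fh wit.
pose hA A b := if b \in D :\: A then 'X_b else h b : R.
have hAfree A p : free_of D p -> subst (hA A) p = subst h p.
  by apply=> b bD; rewrite /hA inE (negbTE bD) andbF.
pose A i := [set x in take i (enum D)].
exists (fun i => [set f | subst (hA (A i)) f = 0]); split.
- by move=> i _; exact: (prime_kernel (subst _)).
- move=> i iD; have D_gt0 : (0 < #|D|)%N by exact: leq_ltn_trans iD.
  have [a0 _] : exists a, a \in D by apply/card_gt0P.
  have si : (i < size (enum D))%N by rewrite -cardE.
  pose a := nth a0 (enum D) i.
  have aD : a \in D by rewrite -mem_enum mem_nth.
  have aA : a \notin A i.
    by rewrite inE in_take ?mem_enum // index_uniq ?enum_uniq // ltnn.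
  have AS : A i.+1 = a |: A i.
    apply/setP => x; rewrite !inE (take_nth a0) // mem_rcons inE //.
  split=> [f|].
    (* Sending the variable [a] to [h a] turns the substitution of [A i] into that of [A i.+1], so
       the kernel can only grow. *)
    move=> /= e; have := congr1 (subst (fun b => if b == a then h a else 'X_b)) e.
    rewrite subst0 subst_comp => {}e; rewrite -[RHS]e; apply: eq_subst => b.
    rewrite AS /hA !finset.in_setD finset.in_setU1; have [->|ba] := eqVneq b a.
      by rewrite (negbTE aA) aD /= substX eqxx.
    rewrite /=; case: ifP => _; first by rewrite substX (negbTE ba).
    rewrite -[LHS]subst_id; apply: fh => c cD; case: eqP => // ca.
    by rewrite ca aD in cD.
  have [p [q [fp fq p0 pq]]] := wit a aD.
  move=> /(_ ('X_a * p - q)) /=.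
  have -> : subst (hA (A i.+1)) ('X_a * p - q) = 0.
    rewrite substB substM (hAfree _ p) // (hAfree _ q) // substX /hA AS
      finset.in_setD finset.in_setU1 eqxx /=.
    by move: pq; rewrite substM substX => ->; rewrite subrr.
  move=> /(_ erefl) e.
  (* If the witness were already in the smaller kernel, specializing the variable [a] to [h a + 1]
     would leave [subst h p = 0]. *)
  have := congr1 (subst (fun b => if b == a then h a + 1 else 'X_b)) e.
  rewrite subst0 substB substM (hAfree _ p) // (hAfree _ q) // substB substM
    substX /hA finset.in_setD aA aD /=.
  rewrite substX eqxx.
  have ff r : subst (fun b => if b == a then h a + 1 else 'X_b) (subst h r) = subst h r.
    rewrite -[RHS]subst_id; apply: free_of_subst => // c cD; case: eqP => // ca.
    by rewrite ca aD in cD.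
  rewrite !ff mulrDl mul1r addrAC.
  move: pq; rewrite substM substX => ->.
  by rewrite subrr add0r => /eqP; rewrite (negbTE p0).
- apply/seteqP; split => f /=; rewrite (eq_subst (k := h)) // => b;
    by rewrite /hA /A cardE take_size !inE mem_enum andNb.
Qed.

End SubstitutionChain.

(** * The primes of vertex partitions and their heights *)

Section ComponentPrimes.
Local Notation tofrac := (@FracField.tofrac _).
Import GRing.Theory.
Local Open Scope ring_scope.
Variables (K : fieldType) (m n : nat) (k0 : 'I_m).
Local Notation R := {mpoly K[m * n]}.
Local Notation x := (generic_mx K m n).
Implicit Types (S : {set 'I_n}) (rho : 'I_n -> 'I_n).

Definition entrywise T (F : 'I_m -> 'I_n -> T) (a : 'I_(m * n)) : T :=
  mxvec (\matrix_(k, i) F k i) 0 a.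

Lemma entrywiseE T (F : 'I_m -> 'I_n -> T) k i :
  entrywise F (mxvec_index k i) = F k i.
Proof. by rewrite /entrywise mxvecE mxE. Qed.

Lemma generic_mxE k i : x k i = 'X_(mxvec_index k i).
Proof. by rewrite mxE. Qed.

Local Notation msubst F := (subst (entrywise F)).

Lemma msubstX F k i : msubst F (x k i) = F k i.
Proof. by rewrite generic_mxE substX entrywiseE. Qed.

(* K[X] modulo the prime of (S, rho) is the monomial algebra in which column i
   is a multiple of one generic column for each value of rho off S; the generic
   columns are normalized to have the entry 1 in row k0. *)
Definition component_param S rho (k : 'I_m) (i : 'I_n) : R :=
  if i \in S then 0 else if k == k0 then x k0 i else x k (rho i) * x k0 i.

Definition component_prime S rho : set R :=
  [set f | msubst (component_param S rho) f = 0]%classic.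

(** The complement of the parameters of [component_param], which are row [k0] off [S] and the
    columns fixed by [rho] off [S]. Its cardinality will be the height. *)
Definition dependent_entries S rho : {set 'I_(m * n)} :=
  [set mxvec_index p.1 p.2 | p : 'I_m * 'I_n &
    (p.2 \in S) || (p.1 != k0) && (rho p.2 != p.2)].

Lemma mxvec_index_inj k i k' i' :
  mxvec_index k i = mxvec_index k' i' :> 'I_(m * n) -> (k, i) = (k', i').
Proof.
by move=> /(congr1 (entrywise pair)); rewrite !entrywiseE.
Qed.

Lemma in_dependent_entries S rho k i :
  (mxvec_index k i \in dependent_entries S rho) =
  (i \in S) || (k != k0) && (rho i != i).
Proof.
apply/imsetP/idP => [[[k' i']]|h]; last by exists (k, i); rewrite ?inE.
by rewrite inE /= => h /mxvec_index_inj [-> ->].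
Qed.

(** A column of [S] contributes [m] entries, any other column moved by [rho] contributes [m - 1].
    The term of the fixed columns stands on the left to avoid truncated subtraction. *)
Lemma card_dependent_entries S rho :
  (#|dependent_entries S rho| +
   (m - 1) * #|[set i | (i \notin S) && (rho i == i)]| = #|S| + (m - 1) * n)%N.
Proof.
have -> : (#|S| + (m - 1) * n = m * #|S| + (m - 1) * (n - #|S|))%N.
  have Sn : (#|S| <= n)%N by rewrite -[X in (_ <= X)%N]card_ord max_card.
  have -> : ((m - 1) * n = (m - 1) * #|S| + (m - 1) * (n - #|S|))%N by rewrite -mulnDr subnKC.
  by rewrite addnA -mulSn subn1 prednK // (leq_ltn_trans _ (ltn_ord k0)).
rewrite card_imset; last first.
  by move=> [k i] [k' i'] /mxvec_index_inj.
pose A : {set 'I_m * 'I_n} := finset.setX [set: 'I_m] S.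
pose B := [set i | (i \notin S) && (rho i != i)].
have -> : [set p : 'I_m * 'I_n | (p.2 \in S) || (p.1 != k0) && (rho p.2 != p.2)] =
    A :|: finset.setX [set~ k0] B.
  apply/setP => -[k i]; rewrite !inE /=.
  by case: (i \in S); rewrite ?andbF ?orbT ?orbF.
rewrite cardsU (_ : A :&: _ = finset.set0) ?cards0 ?subn0; last first.
  by apply/setP => -[k i]; rewrite !inE /=; case: (i \in S); rewrite ?andbF ?andFb.
rewrite !cardsX cardsT cardsC1 card_ord subn1 -addnA -mulnDr; congr (_ + _ * _)%N.
have -> : (n - #|S| = #|~: S|)%N by rewrite -[X in (X - _)%N]card_ord -(cardsC S) addKn.
rewrite -(cardsID [set i | rho i != i] (~: S)).
by congr (_ + _)%N; apply: eq_card => i; rewrite !inE ?negbK // andbC.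
Qed.

Section Height.
Variables (S : {set 'I_n}) (rho : 'I_n -> 'I_n).
Hypothesis rhoS : forall i, i \notin S -> rho i \notin S.
Hypothesis rhoK : forall i, rho (rho i) = rho i.
Local Notation D := (dependent_entries S rho).

Lemma component_prime_prime : prime_ideal (component_prime S rho).
Proof. exact: (prime_kernel (msubst _)). Qed.

Lemma component_param_free k i : free_of D (component_param S rho k i).
Proof.
rewrite /component_param; case: ifPn => iS; first exact: free_of0.
have f0 : free_of D (x k0 i).
  by rewrite generic_mxE; apply: free_ofX; rewrite in_dependent_entries eqxx (negbTE iS).
case: ifPn => // kk; apply: free_ofM => //.
rewrite generic_mxE; apply: free_ofX.
by rewrite in_dependent_entries rhoK eqxx andbF (negbTE (rhoS iS)).
Qed.

(** On the entries outside [D] the parametrization is inverted in the fraction field by [theta],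
    which divides each entry off row [k0] by the entry of row [k0] in its column. *)
Lemma component_prime_indep : indep_mod #|~: D| (component_prime S rho).
Proof.
pose F (j : 'I_#|~: D|) : R := 'X_(enum_val j).
exists F => g /= e.
pose theta : {rmorphism R -> {fraction R}} :=
  mmap ((@FracField.tofrac R) \o (@mpolyC (m * n) K))
  (entrywise (fun k i => if k == k0 then tofrac (x k i) else tofrac (x k i) / tofrac (x k0 i))).
have g0 : mmap (@mpolyC (m * n) K) F g = 0.
  apply/eqP; rewrite -tofrac_eq0; apply/eqP.
  have := congr1 theta e; rewrite rmorph0 => <-.
  apply: (mpoly_hom_eq (f1 := @FracField.tofrac R \o mmap (@mpolyC (m * n) K) F)
    (f2 := theta \o msubst (component_param S rho) \o mmap (@mpolyC (m * n) K) F)) => [c|j] /=.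
    by rewrite mmapC substC /= mmapC.
  rewrite mmapX mmap1U /F; have := enum_valP j; case/mxvec_indexP: (enum_val j) => k i.
  rewrite inE in_dependent_entries negb_or negb_and !negbK => /andP[iS h].
  rewrite substX entrywiseE /component_param (negbTE iS) -generic_mxE.
  have [->|kk] := eqVneq k k0.
    by rewrite generic_mxE /= mmapX mmap1U entrywiseE eqxx generic_mxE.
  move: h; rewrite (negbTE kk) /= => /eqP ->; rewrite rmorphM /= !generic_mxE.
  rewrite !mmapX !mmap1U !entrywiseE (negbTE kk) eqxx divfK; first by rewrite generic_mxE.
  by rewrite tofrac_eq0 generic_mxE mpolyX_neq0.
(* [back] renames the variables outside [D] to those of the small polynomial ring, and kills the
   others. *)
pose back : {rmorphism R -> {mpoly K[#|~: D|]}} := mmap (@mpolyC _ K)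
  (fun a => if [pick j | enum_val j == a] is Some j then 'X_j else 0).
have := congr1 back g0; rewrite rmorph0 => <-; symmetry.
apply: (mpoly_hom_eq (f1 := back \o mmap (@mpolyC (m * n) K) F) (f2 := idfun)) => [c|j].
  by rewrite /= !mmapC.
rewrite /= !(mmapX, mmap1U); case: pickP => [j' /eqP /enum_val_inj -> //|/(_ j)].
by rewrite eqxx.
Qed.

Lemma component_prime_height : has_height (component_prime S rho) #|D|.
Proof.
split; last first.
  move=> k /(prime_chain_leq component_prime_indep).
  have := cardsC D; rewrite card_ord; lia.
apply: subst_prime_chain => [b|a].
  by case/mxvec_indexP: b => k i; rewrite entrywiseE; exact: component_param_free.
case/mxvec_indexP: a => k i; rewrite in_dependent_entries.
have [iS _|iS /= /andP[kk ri]] := boolP (i \in S).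
  (* For a column of [S] the witness is the variable itself. *)
  exists 1, 0; rewrite mulr1 subst1 subst0; split=> //.
  - exact: free_of1.
  - exact: free_of0.
  - exact: oner_neq0.
  - by rewrite substX entrywiseE /component_param iS.
(* The witness is the minor of rows [k], [k0] and columns [i], [rho i]. *)
exists (x k0 (rho i)), (x k (rho i) * x k0 i).
have fr k' j : (j \notin S) -> (k' == k0) || (rho j == j) -> free_of D (x k' j).
  move=> jS h; rewrite generic_mxE; apply: free_ofX.
  by rewrite in_dependent_entries (negbTE jS) /= -negb_or h.
split.
- by apply: fr; rewrite ?eqxx ?rhoS.
- by apply: free_ofM; apply: fr; rewrite ?rhoK ?eqxx ?orbT ?rhoS.
- rewrite msubstX /component_param (negbTE (rhoS iS)) eqxx.
  by rewrite generic_mxE mpolyX_neq0.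
- rewrite -generic_mxE !substM !msubstX /component_param.
  by rewrite (negbTE (rhoS iS)) (negbTE iS) eqxx (negbTE kk) rhoK mulrAC.
Qed.
End Height.
End ComponentPrimes.
Arguments component_prime K {m n} k0 S rho _.

(** * Closure properties and induction for generated ideals *)

Section GeneratedIdeals.
Import GRing.Theory.
Local Open Scope ring_scope.
Local Open Scope classical_set_scope.
Variable R : comNzRingType.
Implicit Types (A I : set R) (f g a : R).

Lemma ideal_generated_mem A f : A f -> ideal_generated A f.
Proof.
move=> Af; exists [:: (1, f)] => [p|]; first by rewrite inE => /eqP ->.
by rewrite big_seq1 mul1r.
Qed.

Lemma ideal_generated0 A : ideal_generated A 0.
Proof. by exists [::]; rewrite ?big_nil. Qed.

Lemma ideal_generatedD A f g :
  ideal_generated A f -> ideal_generated A g -> ideal_generated A (f + g).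
Proof.
move=> [s sA ->] [t tA ->]; exists (s ++ t); last by rewrite big_cat.
by move=> p; rewrite mem_cat => /orP[/sA|/tA].
Qed.

Lemma ideal_generatedMl A a f : ideal_generated A f -> ideal_generated A (a * f).
Proof.
move=> [s sA ->]; exists [seq (a * p.1, p.2) | p <- s].
  by move=> _ /mapP[p /sA ps ->].
by rewrite big_map mulr_sumr; apply: eq_bigr => p _; rewrite mulrA.
Qed.

Lemma ideal_generatedMr A a f : ideal_generated A f -> ideal_generated A (f * a).
Proof. by rewrite mulrC; exact: ideal_generatedMl. Qed.

Lemma ideal_generatedN A f : ideal_generated A f -> ideal_generated A (- f).
Proof. by rewrite -mulN1r; exact: ideal_generatedMl. Qed.

Lemma ideal_generatedB A f g :
  ideal_generated A f -> ideal_generated A g -> ideal_generated A (f - g).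
Proof. by move=> Af /ideal_generatedN; exact: ideal_generatedD. Qed.

Lemma ideal_generated_ind A (Q : R -> Prop) :
  Q 0 -> (forall f g, Q f -> Q g -> Q (f + g)) ->
  (forall a f, A f -> Q (a * f)) -> forall f, ideal_generated A f -> Q f.
Proof.
move=> Q0 QD QM f [s sA ->]; rewrite big_seq; elim/big_ind: _ => // p ps.
exact/QM/sA.
Qed.

Lemma ideal_generated_sub A B :
  A `<=` ideal_generated B -> ideal_generated A `<=` ideal_generated B.
Proof.
move=> AB; apply: ideal_generated_ind; first exact: ideal_generated0.
  exact: ideal_generatedD.
by move=> a f /AB; exact: ideal_generatedMl.
Qed.

End GeneratedIdeals.

(** * Edge minors together with the variables of deleted vertices *)

Section GraphIdeals.
Import GRing.Theory.
Local Open Scope ring_scope.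
Variables (K : fieldType) (m n : nat).
Local Notation R := {mpoly K[m * n]}.
Local Notation x := (generic_mx K m n).
Local Notation msubst F := (subst (entrywise F)).
Implicit Types (S : {set 'I_n}) (e : rel 'I_n) (f g : R).

Definition column_minor k l i j : R := x k i * x l j - x k j * x l i.

(** The edges at [S] need no removal, since their minors lie in the ideal of the variables. Allowing
    a nonempty [S] makes the family closed under the vertex deletions of the induction. *)
Definition graph_generators S e : set R :=
  [set f | (exists k, exists2 i, i \in S & f = x k i) \/
           (exists k l, exists i j, e i j /\ f = column_minor k l i j)]%classic.

Definition graph_ideal S e : set R := ideal_generated (graph_generators S e).

Lemma graph_ideal_var S e k i : i \in S -> graph_ideal S e (x k i).
Proof. by move=> iS; apply: ideal_generated_mem; left; exists k, i. Qed.

Lemma graph_ideal_minor S e k l i j : e i j -> graph_ideal S e (column_minor k l i j).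
Proof. by move=> ij; apply: ideal_generated_mem; right; exists k, l, i, j. Qed.

Lemma binomial_edge_idealE e : binomial_edge_ideal K m e = graph_ideal finset.set0 e.
Proof.
apply/seteqP; split.
  apply: ideal_generated_sub => _ [k [l [i [j [_ ij ->]]]]].
  exact: graph_ideal_minor.
apply: ideal_generated_sub => f [[k [i]]|[k [l [i [j [ij ->]]]]]].
  by rewrite inE.
case: (ltngtP k l) => [kl|lk|/val_inj ->].
- by apply: ideal_generated_mem; exists k, l, i, j.
- have -> : column_minor k l i j = - (x l i * x k j - x l j * x k i).
    by rewrite opprB /column_minor; congr (_ - _); rewrite mulrC.
  by apply: ideal_generatedN; apply: ideal_generated_mem; exists l, k, i, j.
- rewrite /column_minor [x l j * _]mulrC subrr; exact: ideal_generated0.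
Qed.

(** This also puts loops at the neighbours of [v], harmlessly, since the minor of a repeated column
    is zero. *)
Definition neighbour_completion e v : rel 'I_n :=
  fun i j => e i j || e v i && e v j.

(** The property holds for constants and variables and passes to sums and products, the latter by
    [pq - p'q' = p(q - q') + q'(p - p')]. *)
Lemma subst_congr v f :
  ideal_generated [set g | exists k, g = x k v]%classic
    (f - msubst (fun k i => if i == v then 0 else x k i) f).
Proof.
pose pi (k : 'I_m) (i : 'I_n) : R := if i == v then 0 else x k i.
set I := ideal_generated _; change (I (f - msubst pi f)).
elim/mpolyind: f => [|c mu f _ _ IH].
  by rewrite subst0 subrr; exact: ideal_generated0.
rewrite substD opprD addrACA; apply: ideal_generatedD => //.
have IM p q : I (p - msubst pi p) -> I (q - msubst pi q) -> I (p * q - msubst pi (p * q)).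
  move=> Ip Iq; have -> : p * q - msubst pi (p * q) =
      p * (q - msubst pi q) + msubst pi q * (p - msubst pi p).
    by rewrite substM !mulrBr addrA [msubst pi q * p]mulrC subrK [msubst pi q * _]mulrC.
  by apply: ideal_generatedD; apply: ideal_generatedMl.
rewrite -mul_mpolyC; apply: (IM).
  by rewrite substC subrr; exact: ideal_generated0.
rewrite mpolyXE_id; apply: (big_ind (fun p => I (p - msubst pi p))) => [||a _].
- by rewrite subst1 subrr; exact: ideal_generated0.
- exact: IM.
elim: (mu a) => [|d IHd]; first by rewrite expr0 subst1 subrr; exact: ideal_generated0.
rewrite exprS; apply: (IM); last exact: IHd.
case/mxvec_indexP: a {IHd} => k i; rewrite -generic_mxE msubstX /pi; case: eqP => [->|_].
  by rewrite subr0; apply: ideal_generated_mem; exists k.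
by rewrite subrr; exact: ideal_generated0.
Qed.

(* With pi killing column v, write f = pi f + (f - pi f): the first summand is
   controlled by the second hypothesis; in the second one every new minor [a b]
   gets multiplied by an entry of column v, and x_v [a b] is in the ideal of the
   path a, v, b. *)
Lemma graph_ideal_split S e v f : ssrbool.symmetric e ->
  graph_ideal S (neighbour_completion e v) f -> graph_ideal (v |: S) e f ->
  graph_ideal S e f.
Proof.
move=> es.
pose pi k i := if i == v then 0 else x k i.
have pi_minor k l a b : a != v -> b != v ->
    msubst pi (column_minor k l a b) = column_minor k l a b.
  by move=> /negbTE av /negbTE bv; rewrite substB !substM !msubstX /pi av bv.
have pi_minor0 k l a b : (a == v) || (b == v) -> msubst pi (column_minor k l a b) = 0.
  move=> /orP[/eqP ->|/eqP ->]; rewrite substB !substM !msubstX /pi eqxx;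
  by rewrite !(mul0r, mulr0) subrr.
have pi_e g : graph_generators S e g -> graph_ideal S e (msubst pi g).
  case=> [[k [i iS ->]]|[k [l [i [j [ij ->]]]]]].
    rewrite msubstX /pi; case: eqP => _; first exact: ideal_generated0.
    exact: graph_ideal_var.
  have [h|] := boolP ((i == v) || (j == v)).
    by rewrite pi_minor0 //; exact: ideal_generated0.
  by rewrite negb_or => /andP[iv jv]; rewrite pi_minor //; exact: graph_ideal_minor.
move=> fv fS; rewrite -[f](subrK (msubst pi f)); apply: ideal_generatedD; last first.
  move: f fS {fv}; apply: ideal_generated_ind.
  - by rewrite subst0; exact: ideal_generated0.
  - by move=> f g If Ig; rewrite substD; exact: ideal_generatedD.
  - move=> a f gf; rewrite substM; apply: ideal_generatedMl.
    case: gf => [[k [i]]|gf]; last by apply: pi_e; right.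
    rewrite finset.in_setU1 => /orP[/eqP ->|iS ->]; last first.
      by apply: pi_e; left; exists k, i.
    by move=> ->; rewrite msubstX /pi eqxx; exact: ideal_generated0.
move: f fv {fS}; apply: ideal_generated_ind.
- by rewrite subst0 subrr; exact: ideal_generated0.
- by move=> f g If Ig; rewrite substD opprD addrACA; exact: ideal_generatedD.
move=> a f gf; rewrite substM.
have base g : graph_generators S e g ->
    graph_ideal S e (a * g - msubst pi a * msubst pi g).
  move=> gg; apply: ideal_generatedB; apply: ideal_generatedMl.
    exact: ideal_generated_mem.
  exact: pi_e.
case: gf => [gf|[k [l [i [j [/orP[ij|/andP[vi vj]] ->]]]]]].
- by apply: base; left.
- by apply: base; right; exists k, l, i, j.
have [iv|iv] := eqVneq i v.
  by apply: base; right; exists k, l, i, j; rewrite iv.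
have [jv|jv] := eqVneq j v.
  by apply: base; right; exists k, l, i, j; rewrite jv es.
rewrite pi_minor // -mulrBl.
move: (a - _) (subst_congr v a); apply: ideal_generated_ind.
- by rewrite mul0r; exact: ideal_generated0.
- by move=> f1 f2 I1 I2; rewrite mulrDl; exact: ideal_generatedD.
move=> b _ [p ->]; rewrite -mulrA; apply: ideal_generatedMl.
have -> : x p v * column_minor k l i j =
    x l j * column_minor p k v i + x p i * column_minor k l v j + x k j * column_minor l p v i.
  by rewrite /column_minor; ring.
by do 2?apply: ideal_generatedD; apply: ideal_generatedMl; exact: graph_ideal_minor.
Qed.

End GraphIdeals.
Arguments graph_ideal K {m n} S e _.

(** * Kernels of monomial substitutions *)

Section Monomials.
Import GRing.Theory.
Local Open Scope ring_scope.
Variables (K : fieldType) (N : nat).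
Local Notation R := {mpoly K[N]}.
Implicit Types (mu nu : 'X_{1..N}) (h : 'I_N -> R).

Lemma mnm_pos_split mu a : (0 < mu a)%N ->
  exists2 mu', mu = (U_(a) + mu')%MM & 'X_[mu] = 'X_a * 'X_[mu'] :> R.
Proof.
move=> mua; have e : mu = (U_(a) + (mu - U_(a)))%MM.
  rewrite addmC submK //; apply/mnm_lepP => i; rewrite mnm1E.
  by case: eqP => // <-.
by exists (mu - U_(a))%MM => //; rewrite {1}e mpolyXD.
Qed.

Lemma subst_monomial_eq0 h mu :
  reflect (exists2 a, (0 < mu a)%N & h a = 0) (subst h 'X_[mu] == 0).
Proof.
rewrite /subst mmapX /mmap1; apply: (iffP (prodf_eq0 _ _)).
  move=> [a _]; rewrite expf_eq0 => /andP[mua /eqP ha]; by exists a.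
by move=> [a mua ha]; exists a => //; rewrite expf_eq0 mua ha eqxx.
Qed.

Definition zero_or_monomial (p : R) := p = 0 \/ exists mu, p = 'X_[mu].

Lemma zero_or_monomialM p q :
  zero_or_monomial p -> zero_or_monomial q -> zero_or_monomial (p * q).
Proof.
case=> [->|[mu ->]]; first by rewrite mul0r; left.
case=> [->|[nu ->]]; first by rewrite mulr0; left.
by right; exists (mu + nu)%MM; rewrite mpolyXD.
Qed.

Lemma zero_or_monomial_subst h mu :
  (forall a, zero_or_monomial (h a)) -> zero_or_monomial (subst h 'X_[mu]).
Proof.
have mono1 : zero_or_monomial 1 by right; exists 0%MM; rewrite mpolyX0.
move=> hh; rewrite /subst mmapX /mmap1.
apply: (big_ind zero_or_monomial) => // [|a _]; first exact: zero_or_monomialM.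
elim: (mu a) => [|d IH]; first by rewrite expr0.
by rewrite exprS; exact: zero_or_monomialM.
Qed.

(* The terms of f are removed one or two at a time. *)
Lemma kernel_sub_ideal h (A : set R) :
  (forall a, zero_or_monomial (h a)) ->
  (forall mu, subst h 'X_[mu] = 0 -> ideal_generated A 'X_[mu]) ->
  (forall mu nu, subst h 'X_[mu] = subst h 'X_[nu] -> subst h 'X_[mu] != 0 ->
    ideal_generated A ('X_[mu] - 'X_[nu])) ->
  forall f, subst h f = 0 -> ideal_generated A f.
Proof.
move=> hh A0 A2 f; have [s] := ubnP (size (msupp f)); elim: s f => // s IH f fs f0.
have [->|fn0] := eqVneq f 0; first exact: ideal_generated0.
have [mu muf] : exists mu, mu \in msupp f.
  move: fn0; rewrite -msupp_eq0; case: (msupp f) => // mu t _.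
  by exists mu; rewrite mem_head.
have step g : ideal_generated A g -> subst h g = 0 ->
    {subset msupp (f - g) <= rem mu (msupp f)} -> ideal_generated A f.
  move=> Ag g0 sub; rewrite -[f](subrK g); apply: ideal_generatedD => //.
  apply: IH; last by rewrite substB f0 g0 subrr.
  have := uniq_leq_size (msupp_uniq _) sub; rewrite size_rem // => le.
  apply: leq_ltn_trans le _; move: fs.
  by case: (msupp f) muf.
have [mu0|mun0] := eqVneq (subst h 'X_[mu]) 0.
  apply: (step (f@_mu *: 'X_[mu])).
  - by rewrite -mul_mpolyC; apply: ideal_generatedMl; exact: A0.
  - by rewrite -mul_mpolyC substM mu0 mulr0.
  - by move=> nu; rewrite (perm_mem (msupp_rem _ _)).
have [/eqP|[w hw]] := zero_or_monomial_subst mu hh; first by rewrite (negbTE mun0).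
(* If no other term of [f] had the image of [mu], the coefficient at [w] in the image of [f] would
   be that of [f] at [mu], which is nonzero. *)
have [nu [nuf numu hnu]] :
    exists nu, [/\ nu \in msupp f, nu != mu & subst h 'X_[nu] = subst h 'X_[mu]].
  apply: contrapT => no; move: (muf); rewrite mcoeff_msupp => /eqP; apply.
  have := congr1 (mcoeff w) f0; rewrite mcoeff0 [f in subst h f]mpolyE.
  rewrite rmorph_sum raddf_sum /= (bigD1_seq mu) //= ?msupp_uniq //.
  rewrite -mul_mpolyC substM substC mul_mpolyC mcoeffZ hw mcoeffX eqxx mulr1.
  rewrite big_seq_cond big1 ?addr0 // => nu /andP[nuf numu].
  rewrite -mul_mpolyC substM substC mul_mpolyC mcoeffZ.
  have [->|[w' e]] := zero_or_monomial_subst nu hh; first by rewrite mcoeff0 mulr0.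
  rewrite e mcoeffX; case: eqP => [ww|]; last by rewrite mulr0.
  by case: no; exists nu; rewrite e ww hw.
(* This moves the coefficient of [mu] onto [nu], which is in the support already, so the support
   shrinks. *)
apply: (step (f@_mu *: ('X_[mu] - 'X_[nu]))).
- by rewrite -mul_mpolyC; apply: ideal_generatedMl; exact: A2.
- by rewrite -mul_mpolyC substM substB hnu subrr mulr0.
move=> la; rewrite mem_rem_uniq ?msupp_uniq // inE /= !mcoeff_msupp.
rewrite mcoeffB mcoeffZ mcoeffB !mcoeffX.
have [->|lamu] := eqVneq la mu; first by rewrite (negbTE numu) subr0 mulr1 subrr eqxx.
rewrite sub0r; have [<-|] := eqVneq nu la; first by move: nuf; rewrite mcoeff_msupp.
by rewrite oppr0 mulr0 subr0.
Qed.

End Monomials.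

(** * The prime as a graph ideal when the classes are cliques *)

Section Straightening.
Import GRing.Theory.
Local Open Scope ring_scope.
Variables (K : fieldType) (m n : nat) (k0 : 'I_m).
Local Notation R := {mpoly K[m * n]}.
Local Notation x := (generic_mx K m n).
Local Notation msubst F := (subst (entrywise F)).
Local Notation idx := (@mxvec_index m n).
Variables (S : {set 'I_n}) (rho : 'I_n -> 'I_n) (e : rel 'I_n).
Implicit Types mu nu la : 'X_{1..m * n}.
Local Notation phi := (msubst (component_param K k0 S rho)).

Lemma generic_mx_neq0 k i : x k i != 0.
Proof. by rewrite generic_mxE mpolyX_neq0. Qed.

Lemma component_param_eq0 k i : (component_param K k0 S rho k i == 0) = (i \in S).
Proof.
rewrite /component_param; case: ifP => _; first by rewrite eqxx.
by case: ifP; rewrite ?mulf_eq0 !(negbTE (generic_mx_neq0 _ _)).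
Qed.

Lemma column_minor_kernel k l i j : (i \notin S -> j \notin S -> rho i = rho j) ->
  phi (column_minor K k l i j) = 0.
Proof.
move=> er; rewrite substB !substM !msubstX /component_param.
have [iS|iS] := boolP (i \in S); first by rewrite mul0r mulr0 subrr.
have [jS|jS] := boolP (j \in S); first by rewrite mul0r mulr0 subrr.
by rewrite er //; case: (k == k0); case: (l == k0); ring.
Qed.

Lemma graph_ideal_sub_component_prime :
  (forall i j, i \notin S -> j \notin S -> e i j -> rho i = rho j) ->
  (graph_ideal K S e `<=` component_prime K k0 S rho)%classic.
Proof.
move=> er; apply: ideal_generated_ind => [|f g|a f]; rewrite /component_prime /=.
- by rewrite subst0.
- by rewrite substD => -> ->; rewrite addr0.
- rewrite substM => gf; suff -> : phi f = 0 by rewrite mulr0.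
  case: gf => [[k [i iS ->]]|[k [l [i [j [ij ->]]]]]].
    by apply/eqP; rewrite msubstX component_param_eq0.
  by apply: column_minor_kernel => iS jS; exact: er.
Qed.

Hypothesis e_clique :
  forall i j, i \notin S -> j \notin S -> rho i = rho j -> i != j -> e i j.

(* A variable x_{k i}, k != k0, of mu forces nu to contain some x_{k j} with j in
   the class of i, and some x_{l i}; exchanging their rows yields x_{k i}. *)
Lemma monomial_exchange mu nu k i : k != k0 -> (0 < mu (idx k i))%N ->
  phi 'X_[mu] = phi 'X_[nu] -> phi 'X_[mu] != 0 ->
  exists nu', [/\ (0 < nu' (idx k i))%N, mdeg nu' = mdeg nu,
    graph_ideal K S e ('X_[nu] - 'X_[nu']) & phi 'X_[nu'] = phi 'X_[nu]].
Proof.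
move=> kk0 muki phimn phi0.
have offS ka (la : 'X_{1..m * n}) i' : phi 'X_[la] != 0 -> (0 < la (idx ka i'))%N -> i' \notin S.
  move=> la0 lai; apply: contra la0 => iS; apply/subst_monomial_eq0.
  by exists (idx ka i') => //; apply/eqP; rewrite entrywiseE component_param_eq0.
have iS := offS _ _ _ phi0 muki.
have nu0 : phi 'X_[nu] != 0 by rewrite -phimn.
(* A substitution killing the image of one variable of [mu] kills the image of [mu], which is that
   of [nu], hence the image of some variable of [nu]. Killing a single parameter thus detects where
   that parameter comes from in [nu]. *)
have detect (F : 'I_m -> 'I_n -> R) : msubst F (phi 'X_(idx k i)) = 0 ->
    exists k' j, [/\ (0 < nu (idx k' j))%N, j \notin S &
      msubst F (component_param K k0 S rho k' j) = 0].
  move=> F0; have /subst_monomial_eq0[a] :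
      subst (fun a => msubst F (entrywise (component_param K k0 S rho) a)) 'X_[nu] == 0.
    rewrite -subst_comp -phimn subst_comp; apply/subst_monomial_eq0.
    by exists (idx k i) => //; move: F0; rewrite substX.
  case/mxvec_indexP: a => k' j nua; rewrite entrywiseE => ha.
  by exists k', j; split => //; exact: (offS _ _ _ nu0 nua).
have phiki : phi 'X_(idx k i) = x k (rho i) * x k0 i.
  by rewrite substX entrywiseE /component_param (negbTE iS) (negbTE kk0).
(* The parameter killed is the entry of row [k] in the representative column of [i]. *)
have [j [nukj jS rji]] : exists j, [/\ (0 < nu (idx k j))%N, j \notin S & rho j = rho i].
  have [|k' [j [nukj jS]]] :=
      detect (fun k' j => if (k' == k) && (j == rho i) then 0 else x k' j).
    by rewrite phiki substM !msubstX !eqxx mul0r.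
  rewrite /component_param (negbTE jS); case: ifP => [_|k'k0].
    rewrite msubstX [k0 == k]eq_sym (negbTE kk0) /= => /eqP.
    by rewrite (negbTE (generic_mx_neq0 _ _)).
  rewrite substM !msubstX [k0 == k]eq_sym (negbTE kk0) /= => /eqP.
  rewrite mulf_eq0 (negbTE (generic_mx_neq0 k0 j)) orbF.
  case: ifP => [/andP[/eqP k'k /eqP rji] _|_]; last by rewrite (negbTE (generic_mx_neq0 _ _)).
  by exists j; rewrite -k'k rji.
(* The parameter killed is the entry of row [k0] in column [i]; only column [i] involves it through
   its scaling factor. *)
have [l nuli] : exists l, (0 < nu (idx l i))%N.
  have [|l [i' [nuli i'S]]] :=
      detect (fun k' j => if (k' == k0) && (j == i) then 0 else x k' j).
    by rewrite phiki substM !msubstX !eqxx mulr0.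
  rewrite /component_param (negbTE i'S); case: ifP => [_|lk0].
    rewrite msubstX eqxx /= => /eqP; case: ifP => [/eqP <- _|_]; first by exists l.
    by rewrite (negbTE (generic_mx_neq0 _ _)).
  rewrite substM !msubstX eqxx lk0 /= => /eqP.
  rewrite mulf_eq0 (negbTE (generic_mx_neq0 _ _)) /=.
  by case: ifP => [/eqP <- _|_]; [exists l | rewrite (negbTE (generic_mx_neq0 _ _))].
have [/idP ki|ki] := boolP (0 < nu (idx k i))%N.
  by exists nu; split => //; rewrite subrr; exact: ideal_generated0.
have ij : i != j by apply: contra ki => /eqP ->.
have kl : k != l by apply: contra ki => /eqP ->.
have [nu1 nuE XnuE] := mnm_pos_split K nukj.
have nu1li : (0 < nu1 (idx l i))%N.
  move: nuli; rewrite nuE mnmDE mnm1E; case: eqP => // /mxvec_index_inj [_ ji].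
  by rewrite ji eqxx in ij.
have [nu2 nu1E Xnu1E] := mnm_pos_split K nu1li.
exists (U_(idx k i) + (U_(idx l j) + nu2))%MM.
have XE : 'X_[nu] - 'X_[(U_(idx k i) + (U_(idx l j) + nu2))%MM] =
    - 'X_[nu2] * column_minor K k l i j.
  rewrite XnuE Xnu1E !mpolyXD /column_minor !generic_mxE; ring.
have minor_in : graph_ideal K S e (column_minor K k l i j).
  by apply: graph_ideal_minor; apply: e_clique.
split.
- by rewrite mnmDE mnm1E eqxx.
- by rewrite nuE nu1E !mdegD !mdeg1.
- by rewrite XE; exact: ideal_generatedMl.
- apply/eqP; rewrite eq_sym -subr_eq0 -substB XE substM.
  by rewrite column_minor_kernel ?mulr0.
Qed.

(** Induction on the total degree: a variable of [mu] off row [k0] is exchanged into [nu] and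
    cancelled from both, and symmetrically. Monomials supported in row [k0] are fixed by the
    parametrization, so there equal images mean equal monomials. *)
Lemma monomial_congruence mu nu : phi 'X_[mu] = phi 'X_[nu] -> phi 'X_[mu] != 0 ->
  graph_ideal K S e ('X_[mu] - 'X_[nu]).
Proof.
have [d] := ubnP (mdeg mu + mdeg nu); elim: d mu nu => // d IH.
have main mu nu k i : (mdeg mu + mdeg nu < d.+1)%N -> phi 'X_[mu] = phi 'X_[nu] ->
    phi 'X_[mu] != 0 -> k != k0 -> (0 < mu (idx k i))%N ->
    graph_ideal K S e ('X_[mu] - 'X_[nu]).
  move=> dmn phimn phi0 kk0 muki.
  have [nu' [nu'ki dnu' Inu phinu]] := monomial_exchange kk0 muki phimn phi0.
  have -> : 'X_[mu] - 'X_[nu] = ('X_[mu] - 'X_[nu']) - ('X_[nu] - 'X_[nu']) :> R.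
    by rewrite opprB addrA subrK.
  apply: ideal_generatedB => //.
  have [mu1 muE XmuE] := mnm_pos_split K muki.
  have [nu1 nuE XnuE] := mnm_pos_split K nu'ki.
  move: phi0; rewrite XmuE substM mulf_eq0 negb_or => /andP[ki0 mu10].
  rewrite XnuE -mulrBr; apply: ideal_generatedMl; apply: IH => //.
    by move: dmn; rewrite -dnu' muE nuE !mdegD !mdeg1; lia.
  apply: (mulfI ki0); rewrite -!substM -XmuE -XnuE phimn phinu //.
move=> mu nu dmn phimn phi0.
have [[k [i /andP[kk0 muki]]]|mu_row] :=
    pselect (exists k i, (k != k0) && (0 < mu (idx k i))%N).
  exact: main dmn phimn phi0 kk0 muki.
have [[k [i /andP[kk0 nuki]]]|nu_row] :=
    pselect (exists k i, (k != k0) && (0 < nu (idx k i))%N).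
  rewrite -opprB; apply: ideal_generatedN; apply: main kk0 nuki => //.
    by rewrite addnC.
  by rewrite -phimn.
have row_fixed la : phi 'X_[la] != 0 ->
    ~ (exists k i, (k != k0) && (0 < la (idx k i))%N) -> phi 'X_[la] = 'X_[la].
  move=> la0 la_row; rewrite -[RHS]subst_id /subst !mmapX; apply: eq_bigr => a _.
  have [->|] := posnP (la a); first by rewrite !expr0.
  case/mxvec_indexP: a => k i laki; congr (_ ^+ _); rewrite entrywiseE.
  have iS : i \notin S.
    apply: contra la0 => iS; apply/subst_monomial_eq0; exists (idx k i) => //.
    by apply/eqP; rewrite entrywiseE component_param_eq0.
  rewrite /component_param (negbTE iS); case: eqP => [->|/eqP kk0].
    by rewrite generic_mxE.
  by case: la_row; exists k, i; rewrite kk0.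
rewrite -(row_fixed mu) // phimn row_fixed -?phimn // subrr.
exact: ideal_generated0.
Qed.

Lemma component_prime_sub_graph_ideal :
  (component_prime K k0 S rho `<=` graph_ideal K S e)%classic.
Proof.
apply: kernel_sub_ideal.
- case/mxvec_indexP => k i; rewrite entrywiseE /component_param.
  have mono k' j : zero_or_monomial (x k' j).
    by right; rewrite generic_mxE; exists U_(idx k' j)%MM.
  case: ifP => _; first by left.
  by case: ifP => _ //; exact: zero_or_monomialM.
- move=> mu /eqP/subst_monomial_eq0[a]; case/mxvec_indexP: a => k i muki.
  move=> /eqP; rewrite entrywiseE component_param_eq0 => iS.
  have [mu' _ ->] := mnm_pos_split K muki; rewrite -generic_mxE.
  by apply: ideal_generatedMr; exact: graph_ideal_var.
- exact: monomial_congruence.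
Qed.

End Straightening.

(** * Components after deletion of vertices, and cut sets *)

Section VertexDeletion.
Variables (n : nat) (e : rel 'I_n).
Hypothesis e_sym : ssrbool.symmetric e.
Implicit Types (S T : {set 'I_n}).

(** The vertices of [S] remain as isolated points, so that the type of vertices does not change;
    counts of components must therefore exclude them. *)
Definition delete_vertices S : rel 'I_n := fun i j => [&& i \notin S, j \notin S & e i j].

Definition component S (i : 'I_n) : 'I_n := fingraph.root (delete_vertices S) i.

Lemma delete_vertices_sym S : connect_sym (delete_vertices S).
Proof. by apply: sym_connect_sym => i j; rewrite /delete_vertices e_sym andbCA. Qed.

Lemma component_eq S i j : (component S i == component S j) = connect (delete_vertices S) i j.
Proof. exact: root_connect (delete_vertices_sym S) i j. Qed.

Lemma component_edge S i j : i \notin S -> j \notin S -> e i j -> component S i = component S j.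
Proof.
by move=> iS jS ij; apply/eqP; rewrite component_eq connect1 // /delete_vertices iS jS.
Qed.

Lemma component_idem S i : component S (component S i) = component S i.
Proof. exact: root_root (delete_vertices_sym S) i. Qed.

(** Induction along a path; labellings constant on the remaining edges are the means of telling
    components apart. *)
Lemma component_invariant S (T : eqType) (c : 'I_n -> T) i j :
  (forall a b, a \notin S -> b \notin S -> e a b -> c a = c b) ->
  component S i = component S j -> c i = c j.
Proof.
move=> ce /eqP; rewrite component_eq => /connectP[p pp ->].
by elim: p i pp => //= a p IH i /andP[/and3P[iS aS ia] /IH <-]; exact: ce.
Qed.

Lemma component_notin S i : i \notin S -> component S i \notin S.
Proof.
move=> iS; have /(component_invariant (c := fun i => i \in S)) <- // :
    component S i = component S (component S i) by rewrite component_idem.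
by move=> a b /negbTE -> /negbTE ->.
Qed.

Definition number_of_components S := #|[set i | (i \notin S) && (component S i == i)]|.

(** Putting back any one vertex of [S] merges at least two components. *)
Definition cut_set S := forall i, i \in S ->
  exists a b, [/\ a \notin S, b \notin S, e i a, e i b & component S a != component S b].

End VertexDeletion.

(** * Inclusions between the primes of vertex sets *)

Section PrimeDecomposition.
Import GRing.Theory.
Local Open Scope ring_scope.
Variables (K : fieldType) (m n : nat) (k0 k1 : 'I_m).
Hypothesis k10 : k1 != k0.
Local Notation R := {mpoly K[m * n]}.
Local Notation x := (generic_mx K m n).
Local Notation msubst F := (subst (entrywise F)).
Implicit Types (S T : {set 'I_n}) (e : rel 'I_n) (f : R) (rho : 'I_n -> 'I_n).

(** The parametrization of [(T, rho')] factors through that of [(S, rho)]: kill the columns of [T]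
    and send the generic column of a class of [rho] to that of the class of [rho'] containing it. *)
Lemma component_prime_subset S T rho rho' : S \subset T ->
  (forall i j, i \notin T -> j \notin T -> rho i = rho j -> rho' i = rho' j) ->
  (component_prime K k0 S rho `<=` component_prime K k0 T rho')%classic.
Proof.
move=> ST compat f; rewrite /component_prime /= => f0.
(* The default [i] concerns only values that [rho] does not take off [T]. *)
pose g i := if [pick j | (j \notin T) && (rho j == i)] is Some j then rho' j else i.
pose psi k i : R := if k == k0 then if i \in T then 0 else x k0 i else x k (g i).
have gE i : i \notin T -> g (rho i) = rho' i.
  move=> iT; rewrite /g; case: pickP => [j /andP[jT /eqP]|/(_ i)]; first exact: compat.
  by rewrite iT eqxx.
have := congr1 (msubst psi) f0; rewrite subst0 => <-; rewrite subst_comp.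
apply: eq_subst => a; case/mxvec_indexP: a => k i; rewrite !entrywiseE /component_param.
have [iT|iT] := boolP (i \in T).
  case: ifP => _; first by rewrite subst0.
  by case: ifP => _; rewrite ?substM !msubstX /psi eqxx iT ?mulr0.
have -> : i \in S = false by apply/negP => /(fintype.subsetP ST); apply/negP.
case: ifPn => kk0; rewrite ?substM !msubstX /psi eqxx (negbTE iT) //.
by rewrite (negbTE kk0) gE.
Qed.

Lemma var_in_component_prime S rho k i : component_prime K k0 S rho (x k i) <-> i \in S.
Proof.
rewrite /component_prime /= msubstX -(component_param_eq0 K k0 S rho k i).
by split => [->|/eqP //]; rewrite eqxx.
Qed.

(** A second row makes the classes visible: the image of the minor is a nonzero multiple of a
    difference of two variables of row [k1]. *)
Lemma minor_in_component_prime S rho i j : i \notin S -> j \notin S ->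
  component_prime K k0 S rho (column_minor K k0 k1 i j) -> rho i = rho j.
Proof.
move=> iS jS; rewrite /component_prime /= substB !substM !msubstX /component_param.
rewrite (negbTE iS) (negbTE jS) eqxx (negbTE k10).
have -> : x k0 i * (x k1 (rho j) * x k0 j) - x k0 j * (x k1 (rho i) * x k0 i) =
   x k0 i * x k0 j * (x k1 (rho j) - x k1 (rho i)) by ring.
move=> /eqP; rewrite !mulf_eq0 !(negbTE (generic_mx_neq0 _ _ _)) /= subr_eq0.
rewrite !generic_mxE => /eqP/(congr1 (mcoeff U_(mxvec_index k1 (rho j))%MM)).
rewrite !mcoeffXU eqxx; case: eqP => [/mxvec_index_inj[] //|_ /eqP].
by rewrite oner_eq0.
Qed.

Variable e : rel 'I_n.
Hypothesis e_sym : ssrbool.symmetric e.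
Local Notation J := (binomial_edge_ideal K m e).
Local Notation P S := (component_prime K k0 S (component e S)).

Lemma cut_prime_is_prime S : prime_ideal (P S).
Proof. exact: component_prime_prime. Qed.

Lemma binomial_edge_ideal_sub_prime S : (J `<=` P S)%classic.
Proof.
rewrite binomial_edge_idealE => f Jf.
have : graph_ideal K S e f.
  move: f Jf; apply: ideal_generated_sub => f [[k [i]]|[k [l [i [j [ij ->]]]]]].
    by rewrite inE.
  exact: graph_ideal_minor.
apply: graph_ideal_sub_component_prime => i j iS jS; exact: component_edge.
Qed.

(** Variables give the inclusion of [T] in [S]. A vertex [i] of [S] outside [T] would link two
    neighbours in [G - T] that are separated in [G - S]; their minor lies in the prime of [T] but
    not in that of [S]. *)
Lemma cut_prime_min S T : cut_set e S -> (P T `<=` P S)%classic -> T = S.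
Proof.
move=> cS TS; have sub : T \subset S.
  apply/fintype.subsetP => i /(var_in_component_prime T (component e T) k0) /TS.
  by move=> /var_in_component_prime.
apply/eqP; rewrite finset.eqEsubset sub /=; apply/fintype.subsetP => i iS; apply: contraT => iT.
have [a [b [aS bS ia ib /eqP[]]]] := cS i iS.
have aT : a \notin T by apply: contra aS; exact: fintype.subsetP.
have bT : b \notin T by apply: contra bS; exact: fintype.subsetP.
apply: (minor_in_component_prime aS bS); apply: TS; rewrite /component_prime /=.
apply: column_minor_kernel => _ _.
by rewrite -(component_edge e_sym iT aT ia); exact: component_edge.
Qed.

(** Putting back a vertex that meets at most one component merges nothing: the labelling by
    components of [G - S] extends to [i]. *)
Lemma cut_prime_delete S i : i \in S ->
  (forall a b, a \notin S -> b \notin S -> e i a -> e i b -> component e S a = component e S b) ->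
  (P (S :\ i) `<=` P S)%classic.
Proof.
move=> iS same; apply: component_prime_subset => [|a b aS bS]; first exact: subD1set.
(* The common label of the neighbours of [i] off [S], or an arbitrary one if there are none. *)
pose r := if [pick j | (j \notin S) && e i j] is Some j then component e S j else i.
pose c j := if j == i then r else component e S j.
have ca j : j \notin S -> c j = component e S j.
  by move=> jS; rewrite /c; case: eqP => // ji; rewrite ji iS in jS.
move=> ab; rewrite -!ca //; apply: component_invariant ab => //.
have ci j : j \notin S -> e i j -> c i = component e S j.
  move=> jS ij; rewrite /c eqxx /r; case: pickP => [k /andP[kS ik]|/(_ j)].
    exact: same.
  by rewrite jS ij.
move=> p q; rewrite !inE !negb_and !negbK => /orP[/eqP ->|pS] /orP[/eqP ->|qS] pq //.
- by rewrite (ca q) //; exact: ci.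
- by rewrite (ca p) //; symmetry; apply: ci => //; rewrite e_sym.
- by rewrite !ca //; exact: component_edge.
Qed.

End PrimeDecomposition.

(** * The ideal as an intersection of primes *)

Section Radical.
Import GRing.Theory.
Local Open Scope ring_scope.
Variables (K : fieldType) (m n : nat) (k0 : 'I_m).
Implicit Types (S T : {set 'I_n}) (f : {mpoly K[m * n]}).

(** Adjacency to [i] propagates along a path: each vertex of the path has both [i] and its successor
    as neighbours. *)
Lemma clique_component (e : rel 'I_n) S : ssrbool.symmetric e ->
  (forall v a b, v \notin S -> a \notin S -> b \notin S -> e v a -> e v b -> a != b -> e a b) ->
  forall i j, i \notin S -> j \notin S -> component e S i = component e S j -> i != j -> e i j.
Proof.
move=> es simplicial i j iS jS /eqP; rewrite component_eq // => /connectP[p pp ->].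
elim/last_ind: p pp {jS j} => [|p a IH]; first by rewrite eqxx.
rewrite rcons_path last_rcons => /andP[/IH {}IH /and3P[lS aS la]] ia.
have [il|il] := eqVneq i (last i p); first by rewrite il.
by apply: (simplicial (last i p)) => //; rewrite es IH.
Qed.

(* Induction on the number of non-edges plus the number of vertices off S: at a
   non-simplicial vertex v, graph_ideal_split reduces to completing the
   neighbourhood of v and to deleting v. *)
Lemma graph_ideal_radical (e : rel 'I_n) S f : ssrbool.symmetric e ->
  (forall T, S \subset T -> component_prime K k0 T (component e T) f) ->
  graph_ideal K S e f.
Proof.
have [d] := ubnP (#|[pred p : 'I_n * 'I_n | ~~ e p.1 p.2]| + #|~: S|).
elim: d e S => // d IH e S; rewrite ltnS => dS es fP.
have [[v [a [b [vS [va vb ab nab]]]]]|simplicial] :=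
  pselect (exists v a b, v \notin S /\ [/\ e v a, e v b, a != b & ~~ e a b]).
  apply: (graph_ideal_split es (v := v)).
    have es' : ssrbool.symmetric (neighbour_completion e v).
      by move=> i j; rewrite /neighbour_completion es [e v i && _]andbC.
    apply: (IH _ _ _ es') => [|T ST].
      apply: leq_trans dS; rewrite ltn_add2r; apply: proper_card; apply/properP; split.
        apply/fintype.subsetP => -[i j]; rewrite !inE /neighbour_completion /=.
        by rewrite negb_or => /andP[].
      by exists (a, b); rewrite !inE /neighbour_completion /= ?nab // va vb orbT.
    (* Additional edges give coarser components, hence larger primes. *)
    apply: component_prime_subset (fP T ST) => // i j iT jT.
    apply: component_invariant => // p q pT qT pq; apply: component_edge => //.
    by rewrite /neighbour_completion pq.
  apply: (IH _ _ _ es) => [|T vST].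
    apply: leq_trans dS; rewrite ltn_add2l; apply: proper_card; apply/properP; split.
      by rewrite finset.setCS finset.subsetUr.
    by exists v; rewrite !inE ?vS // eqxx.
  by apply: fP; apply: fintype.subset_trans vST; exact: finset.subsetUr.
apply: (component_prime_sub_graph_ideal (k0 := k0) (rho := component e S)) (fP S _) => //.
apply: clique_component => // v a b vS _ _ va vb ab; apply: contraT => nab.
by case: simplicial; exists v, a, b.
Qed.

End Radical.

(** * Associated primes and unmixedness in terms of cut sets *)

Section AssociatedPrimes.
Import GRing.Theory.
Local Open Scope ring_scope.

Lemma prime_ideal_prod (R : comNzRingType) (P : set R) I (s : seq I) (p : pred I) (F : I -> R) :
  prime_ideal P -> P (\prod_(i <- s | p i) F i) -> exists2 i, p i & P (F i).
Proof.
move=> pP; elim: s => [|i s IH]; first by rewrite big_nil => /(prime_idealN1 pP).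
rewrite big_cons; case: ifP => // pi /(prime_idealM pP) [Fi|/IH //].
by exists i.
Qed.

Lemma prime_ideal_prod_mem (R : comNzRingType) (P : set R) (I : finType) (p : pred I)
    (F : I -> R) i :
  prime_ideal P -> p i -> P (F i) -> P (\prod_(i | p i) F i).
Proof. by move=> pP pi Fi; rewrite (bigD1 i) //= mulrC; exact: prime_idealMl. Qed.

Variables (K : fieldType) (m n : nat) (k0 k1 : 'I_m).
Hypothesis k10 : k1 != k0.
Variable e : rel 'I_n.
Hypothesis e_sym : ssrbool.symmetric e.
Implicit Types (S T : {set 'I_n}).
Local Notation J := (binomial_edge_ideal K m e).
Local Notation P S := (component_prime K k0 S (component e S)).

Lemma binomial_edge_idealP f : J f <-> forall S, P S f.
Proof.
split=> [Jf S|fP]; first exact: binomial_edge_ideal_sub_prime Jf.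
by rewrite binomial_edge_idealE; apply: (graph_ideal_radical (k0 := k0)) => // T _.
Qed.

Lemma not_subset_witness (A B : set {mpoly K[m * n]}) :
  ~ (A `<=` B)%classic -> exists2 a, A a & ~ B a.
Proof.
move=> AB; apply: contrapT => no; apply: AB => a Aa; apply: contrapT => nBa.
by apply: no; exists a.
Qed.

Let prP S : prime_ideal (P S) := cut_prime_is_prime K k0 e S.

(** By minimality every other prime of the intersection has an element outside the prime of [S]; the
    product [f] of these elements satisfies [J : f = P S]. *)
Lemma associated_cut_prime S : cut_set e S -> associated_prime J (P S).
Proof.
move=> cS; split; first exact: prP.
have wit T : exists a, T != S -> P T a /\ ~ P S a.
  have [->|TS] := eqVneq T S; first by exists 0.
  have [|a Pa nPa] := @not_subset_witness (P T) (P S); last by exists a => _; split.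
  by move=> /(cut_prime_min k10 e_sym cS) /eqP; rewrite (negbTE TS).
have [w hw] := choice wit.
exists (\prod_(T | T != S) w T); apply/seteqP; split => a /=.
  move=> Pa; apply/binomial_edge_idealP => T; have [->|TS] := eqVneq T S.
    by rewrite mulrC; exact: prime_idealMl (prP S) Pa.
  apply: (prime_idealMl _ (prP T)).
  by apply: (prime_ideal_prod_mem (p := fun T => T != S) (prP T) TS); have [] := hw T TS.
move=> /binomial_edge_idealP/(_ S)/(prime_idealM (prP S)) [//|].
by move=> /(prime_ideal_prod (prP S)) [T TS wT]; case: (hw T TS) => _ [].
Qed.

(** The colon ideal [Q] is the intersection of the primes that miss [f]; being prime, it equals one
    of these finitely many. *)
Lemma associated_prime_cut Q : associated_prime J Q -> exists2 S, cut_set e S & Q = P S.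
Proof.
move=> [pQ [f Qf]].
have QE a : Q a <-> J (a * f) by rewrite Qf.
have QP T : ~ P T f -> (Q `<=` P T)%classic.
  by move=> nTf a /QE/binomial_edge_idealP/(_ T)/(prime_idealM (prP T)) [].
have [S nSf QS] : exists2 S, ~ P S f & Q = P S.
  apply: contrapT => no.
  have wit T : exists a, ~ P T f -> P T a /\ ~ Q a.
    have [Tf|nTf] := pselect (P T f); first by exists 0.
    have [|a Pa nQa] := @not_subset_witness (P T) Q; last by exists a => _; split.
    by move=> PQ; apply: no; exists T => //; apply/seteqP; split => //; exact: QP.
  have [w hw] := choice wit.
  (* Otherwise a product of elements outside [Q], one from each prime missing [f], would lie in
     [Q]. *)
  have : Q (\prod_(T | ~~ `[< P T f >]) w T).
    apply/QE/binomial_edge_idealP => T; have [Tf|nTf] := pselect (P T f).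
      exact: prime_idealMl (prP T) Tf.
    rewrite mulrC; apply: (prime_idealMl _ (prP T)).
    apply: (prime_ideal_prod_mem (prP T) (i := T)); first by apply/asboolPn.
    by have [] := hw T nTf.
  by move=> /(prime_ideal_prod pQ) [T /asboolPn /hw []].
exists S => // i iS; apply: contrapT => no.
(* If [i] joins no two components, the prime of [S :\ i] is smaller, so it misses [f] too and
   contains [Q], in particular the variables of column [i], which is absurd. *)
have sub : (P (S :\ i) `<=` P S)%classic.
  apply: cut_prime_delete => // a b aS bS ia ib; apply/eqP; apply: contraT => ab.
  by case: no; exists a, b.
have : P (S :\ i) (generic_mx K m n k0 i).
  apply: QP => [/sub //|]; rewrite QS; exact/var_in_component_prime.
by move=> /var_in_component_prime; rewrite !inE eqxx.
Qed.

Local Notation codim S := (#|dependent_entries k0 S (component e S)|).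

Lemma unmixed_binomial_edge_ideal :
  unmixed J <-> exists h, forall S, cut_set e S ->
    (h + (m - 1) * number_of_components e S = #|S| + (m - 1) * n)%N.
Proof.
have ht S : has_height (P S) (codim S).
  by apply: component_prime_height => i; [exact: component_notin | exact: component_idem].
have codimE S := card_dependent_entries k0 S (component e S).
split=> -[h hh]; exists h.
  move=> S cS; rewrite -codimE; congr (_ + _)%N.
  exact: has_height_uniq (hh _ (associated_cut_prime cS)) (ht S).
move=> Q /associated_prime_cut [S cS ->].
suff -> : h = codim S by exact: ht.
by apply/eqP; rewrite -(eqn_add2r ((m - 1) * number_of_components e S)) hh // -codimE.
Qed.

End AssociatedPrimes.

(** * Rotation of the vertices of the cycle *)

Section CyclicShift.
Variable n : nat.
Implicit Types i j s p : 'I_n.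

Lemma shift_subproof i k : (i + k) %% n < n.
Proof. by rewrite ltn_pmod // (leq_ltn_trans _ (ltn_ord i)). Qed.

Definition shift i k : 'I_n := Ordinal (shift_subproof i k).

Lemma val_shift i k : k <= n -> shift i k = (if i + k < n then i + k else i + k - n) :> nat.
Proof.
move=> kn /=; case: ltnP => [ikn|nik]; first by rewrite modn_small.
by rewrite -{1}(subnK nik) modnDr modn_small //; have := ltn_ord i; lia.
Qed.

Lemma shift_add i d k : shift (shift i d) k = shift i (d + k).
Proof. by apply: val_inj; rewrite /= modnDml addnA. Qed.

Lemma shift0 i : shift i 0 = i.
Proof. by apply: val_inj; rewrite /= addn0 modn_small. Qed.

Lemma shift_n i : shift i n = i.
Proof. by apply: val_inj; rewrite /= modnDr modn_small. Qed.

Lemma shift_exists i j : exists2 d, d < n & j = shift i d.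
Proof.
have [ni nj] := (ltn_ord i, ltn_ord j).
have [ij|ji] := leqP i j.
  by exists (j - i); [lia | apply: ord_inj; rewrite val_shift; [case: ifP; lia | lia]].
by exists (j + n - i); [lia | apply: ord_inj; rewrite val_shift; [case: ifP; lia | lia]].
Qed.

End CyclicShift.

(** * Block structure of the cut sets of a power cycle *)

Section PowerCycle.
Variables n r : nat.
Hypothesis r_gt0 : 0 < r.
Local Notation e := (power_cycle n r).
Local Notation comp := (component e).
Implicit Types (i j s p : 'I_n) (S : {set 'I_n}).

Lemma power_cycleE i j : e i j =
  [|| (i < j <= i + r), (j < i <= j + r), (j < i) && (j + n <= i + r)
    | (i < j) && (i + n <= j + r)].
Proof.
rewrite /power_cycle /circular_dist -val_eqE /=; have := ltn_ord i; have := ltn_ord j; lia.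
Qed.

Lemma power_cycle_complete : n <= 2 * r + 1 -> complete_graph e.
Proof.
move=> nr i j; rewrite -val_eqE /= power_cycleE; have := ltn_ord i; have := ltn_ord j; lia.
Qed.

Lemma power_cycle_shift i d : 0 < d < n -> e i (shift i d) = (d <= r) || (n <= d + r).
Proof.
have := ltn_ord i; rewrite power_cycleE => ni dn; rewrite val_shift; last lia.
case: ifP; lia.
Qed.

Lemma component_eq_adjacent S i j : i \notin S -> j \notin S ->
  (i == j) || e i j -> comp S i = comp S j.
Proof.
move=> iS jS /orP[/eqP -> //|]; apply: component_edge => //.
exact: power_cycle_sym.
Qed.

Hypothesis n_large : 2 * r + 2 <= n.

Lemma component_shift S p d :
  (forall k, k <= d -> shift p k \notin S) -> comp S (shift p d) = comp S p.
Proof.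
elim: d => [|d IH] pS; first by rewrite shift0.
rewrite -IH => [|k kd]; last by apply: pS; exact: leqW.
symmetry; apply: component_eq_adjacent; [exact: pS (leqW (leqnn d))|exact: pS|].
have -> : shift p d.+1 = shift (shift p d) 1 by rewrite shift_add addn1.
by rewrite power_cycle_shift ?r_gt0 ?orbT //; lia.
Qed.

Lemma no_cut_connected i j : comp finset.set0 i = comp finset.set0 j.
Proof.
have [d _ ->] := shift_exists i j.
by rewrite component_shift // => k _; rewrite inE.
Qed.

Lemma first_exit S s x : shift s x \notin S ->
  exists2 y, y <= x & shift s y \notin S /\ forall k, k < y -> shift s k \in S.
Proof.
move=> sx; have ex : exists y, shift s y \notin S by exists x.
case: (ex_minnP ex) => y yS ymin; exists y; first exact: ymin.
by split => // k; apply: contraTT => /ymin; rewrite -leqNgt.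
Qed.

(** The backward counterpart of [first_exit]: [shift s (n - x)] lies [x] steps behind [s]. *)
Lemma last_exit S s x : x <= n -> shift s (n - x) \notin S ->
  exists2 y, y <= x & shift s (n - y) \notin S /\ forall k, k < y -> shift s (n - k) \in S.
Proof.
move=> xn sx; have ex : exists y, shift s (n - y) \notin S by exists x.
case: (ex_minnP ex) => y yS ymin; exists y; first exact: ymin.
by split => // k; apply: contraTT => /ymin; rewrite -leqNgt.
Qed.

(* A vertex s of a cut set S has neighbours off S on both sides, in different
   components; the nearest vertices p and q of the complement on both sides are
   then in different components as well, so that q is more than r ahead of p. *)
Lemma cut_set_gap S s : cut_set e S -> s \in S ->
  exists p a, [/\ p \notin S, 0 < a <= r, s = shift p a &
    forall d, 0 < d <= r -> shift p d \in S].
Proof.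
move=> cS sS; have [a [b [aS bS sa sb /eqP ab]]] := cS s sS.
have main x y : 0 < x <= r -> 0 < y <= r -> shift s x \notin S -> shift s (n - y) \notin S ->
    comp S (shift s x) <> comp S (shift s (n - y)) ->
    exists p a, [/\ p \notin S, 0 < a <= r, s = shift p a &
      forall d, 0 < d <= r -> shift p d \in S].
  move=> xr yr sx sy xy.
  have [u ux [uS ub]] := first_exit sx.
  have yn : y <= n by lia.
  have [v vy [vS vb]] := last_exit yn sy.
  have u0 : 0 < u by rewrite lt0n; apply: contraNneq uS => ->; rewrite shift0.
  have v0 : 0 < v by rewrite lt0n; apply: contraNneq vS => ->; rewrite subn0 shift_n.
  have back k : shift (shift s (n - v)) (v + k) = shift s k.
    by rewrite shift_add addnA subnK ?[n + k]addnC -?shift_add ?shift_n //; lia.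
  have sE : s = shift (shift s (n - v)) v by have := back 0; rewrite addn0 shift0.
  have cu : comp S (shift s u) = comp S (shift s x).
    apply: component_eq_adjacent => //; have [->|ux'] := eqVneq u x; first by rewrite eqxx.
    have -> : shift s x = shift (shift s u) (x - u) by rewrite shift_add subnKC.
    rewrite power_cycle_shift ?orbT //; last lia.
    by apply/orP; right; apply/orP; left; lia.
  have cv : comp S (shift s (n - y)) = comp S (shift s (n - v)).
    apply: component_eq_adjacent => //; have [->|vy'] := eqVneq v y; first by rewrite eqxx.
    have -> : shift s (n - v) = shift (shift s (n - y)) (y - v).
      by rewrite shift_add; congr (shift s _); lia.
    by rewrite power_cycle_shift; lia.
  have far : r < v + u.
    rewrite ltnNge; apply/negP => le; apply: xy; rewrite cv -cu; symmetry.
    by apply: component_eq_adjacent => //; rewrite -(back u) power_cycle_shift; lia.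
  exists (shift s (n - v)), v; split => //; first lia.
  (* Up to [s] the choice of [v] applies; beyond [s], the choice of [u] applies because
     [d <= r < v + u]. *)
  move=> d dr; have [dv|vd] := ltnP d v.
    have -> : shift (shift s (n - v)) d = shift s (n - (v - d)).
      by rewrite shift_add; congr (shift s _); lia.
    by apply: vb; lia.
  by rewrite -(subnKC vd) back; apply: ub; lia.
have [x xn ax] := shift_exists s a; have [y yn ay] := shift_exists s b.
have x0 : 0 < x by rewrite lt0n; apply: contraNneq aS => x0; rewrite ax x0 shift0.
have y0 : 0 < y by rewrite lt0n; apply: contraNneq bS => y0; rewrite ay y0 shift0.
move: sa; rewrite ax power_cycle_shift ?x0 // => sa.
move: sb; rewrite ay power_cycle_shift ?y0 // => sb.
have close u v w t : shift s u = w -> shift s v = t -> w \notin S -> t \notin S ->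
    u <= v < u + r + 1 -> v < n -> comp S w = comp S t.
  move=> <- <- wS tS uv vn; apply: component_eq_adjacent => //.
  have [->|uv'] := eqVneq u v; first by rewrite eqxx.
  have -> : shift s v = shift (shift s u) (v - u) by rewrite shift_add subnKC //; lia.
  by rewrite power_cycle_shift; lia.
(* Two neighbours on the same side of [s] are within [r] of each other, hence in one component; so
   one lies ahead of [s] and the other behind. *)
have [xr|rx] := leqP x r; have [yr|ry] := leqP y r.
- case: ab; have [xy|yx] := leqP x y.
    by apply: (close x y) => //; lia.
  by symmetry; apply: (close y x) => //; lia.
- apply: (main x (n - y)); rewrite ?subKn -?ax -?ay //; lia.
- apply: (main y (n - x)); rewrite ?subKn -?ax -?ay //; try lia.
  by move=> h; apply: ab.
- case: ab; have [xy|yx] := leqP x y.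
    by apply: (close x y) => //; lia.
  by symmetry; apply: (close y x) => //; lia.
Qed.

(** One vertex for each block of consecutive vertices of [S]: the one just before it. *)
Definition gap_starts S := [set p | (p \notin S) && (shift p 1 \in S)].

(** The [r] vertices after each gap start lie in [S], and by [cut_set_gap] these runs cover [S].
    They are disjoint, since an overlap would put the start of one run inside another, hence in
    [S]. *)
Lemma card_cut_set S : cut_set e S -> #|S| = #|gap_starts S| * r.
Proof.
move=> cS; pose f (pd : 'I_n * 'I_r) := shift pd.1 pd.2.+1.
have gapP p d : p \in gap_starts S -> 0 < d <= r -> shift p d \in S.
  rewrite inE => /andP[pS p1] dr.
  have [q [a [qS ar p1q qgap]]] := cut_set_gap cS p1.
  (* If [a > 1], then [p] would lie in the run after [q], contrary to [p \notin S]. *)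
  have pq : p = shift q (a - 1).
    have /(congr1 (fun i => shift i (n - 1))) := p1q.
    rewrite !shift_add (_ : 1 + (n - 1) = n) ?shift_n => [->|]; last lia.
    rewrite (_ : a + (n - 1) = n + (a - 1)); last lia.
    by rewrite -shift_add shift_n.
  have [a1|a1] := posnP (a - 1); first by rewrite pq a1 shift0; exact: qgap.
  by case/negP: pS; rewrite pq; apply: qgap; lia.
have inj : {in finset.setX (gap_starts S) [set: 'I_r] &, injective f}.
  have wl p d q d' : p \in gap_starts S -> q \in gap_starts S -> d <= d' -> d' <= r ->
      shift p d = shift q d' -> p = q /\ d = d'.
    move=> pG qG dd d'r /(congr1 (fun i => shift i (n - d))).
    rewrite !shift_add (_ : d + (n - d) = n) ?shift_n => [|]; last lia.
    rewrite (_ : d' + (n - d) = n + (d' - d)); last lia.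
    rewrite -shift_add shift_n => pq.
    have [d0|d0] := posnP (d' - d); first by rewrite pq d0 shift0; split => //; lia.
    move: pG; rewrite inE => /andP[/negP[]]; rewrite pq; apply: gapP qG _; lia.
  move=> [p d] [q d'] /setXP[/= pG _] /setXP[/= qG _]; rewrite /f /= => h.
  have [dr d'r] := (ltn_ord d, ltn_ord d').
  have [dd|dd] := leqP d d'.
    have [-> dd'] := wl p d.+1 q d'.+1 pG qG dd d'r h.
    by congr (_, _); apply: ord_inj; lia.
  have [-> dd'] := wl q d'.+1 p d.+1 qG pG (ltnW dd) dr (esym h).
  by congr (_, _); apply: ord_inj; lia.
transitivity #|f @: finset.setX (gap_starts S) [set: 'I_r]|; last first.
  by rewrite card_in_imset // cardsX cardsT card_ord.
apply: eq_card => s; apply/idP/imsetP => [sS|[[p d]]].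
  have [p [a [pS ar sE pgap]]] := cut_set_gap cS sS.
  have ar' : a - 1 < r by lia.
  exists (p, Ordinal ar'); last by rewrite sE /f /=; congr shift; lia.
  by rewrite !inE pS pgap //; lia.
rewrite !inE andbT /= => pG ->; rewrite /f /=; apply: gapP; rewrite ?inE //.
by have := ltn_ord d; lia.
Qed.

(** Walking forward from a vertex off [S] until just before [S] stays in its component and ends at a
    gap start, so every component contains one. *)
Lemma number_of_components_leq S : S != finset.set0 ->
  number_of_components e S <= #|gap_starts S|.
Proof.
move=> /set0Pn[s sS]; apply: leq_trans (leq_imset_card (comp S) _).
apply: subset_leq_card; apply/fintype.subsetP => i; rewrite inE => /andP[iS /eqP ri].
have [d _ sd] := shift_exists i s.
have ex : exists d, shift i d \in S by exists d; rewrite -sd.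
case: (ex_minnP ex) => -[|y] yS ymin; first by rewrite shift0 (negbTE iS) in yS.
have yb k : k <= y -> shift i k \notin S.
  by move=> ky; apply/negP => /ymin; rewrite ltnNge ky.
apply/imsetP; exists (shift i y); first by rewrite inE yb //= shift_add addn1.
by rewrite component_shift // ri.
Qed.

Lemma card_gap_starts S : #|gap_starts S| <= n - #|S|.
Proof.
have -> : n - #|S| = #|~: S| by rewrite -[X in X - _]card_ord -(cardsC S) addKn.
by apply: subset_leq_card; apply/fintype.subsetP => p; rewrite !inE => /andP[].
Qed.

Lemma number_of_components_empty : number_of_components e finset.set0 = 1.
Proof.
have n0 : 0 < n by lia.
apply/eqP/cards1P; exists (comp finset.set0 (Ordinal n0)); apply/setP => i.
rewrite !inE; apply/eqP/eqP => [<-|->]; first exact: no_cut_connected.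
by rewrite component_idem //; exact: power_cycle_sym.
Qed.

End PowerCycle.

(** * Cut sets with two and three blocks *)

Section ExplicitCutSets.
Variables n r : nat.
Hypothesis r_gt0 : 0 < r.
Local Notation e := (power_cycle n r).
Local Notation comp := (component e).
Implicit Types (S : {set 'I_n}).

Lemma number_of_components_geq S (c : 'I_n -> nat) (s : seq 'I_n) :
  (forall i j, i \notin S -> j \notin S -> e i j -> c i = c j) ->
  all (fun i => i \notin S) s -> uniq (map c s) -> size s <= number_of_components e S.
Proof.
move=> ce sS us; have es := @power_cycle_sym n r.
have us' : uniq (map (comp S) s).
  elim: s us {sS} => //= i s IH /andP[ins /IH ->]; rewrite andbT.
  apply: contra ins => /mapP[j js /(component_invariant es ce) ->].
  exact: map_f.
rewrite -(size_map (comp S)) -(card_uniqP us'); apply: subset_leq_card.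
apply/fintype.subsetP => _ /mapP[i /(allP sS) iS ->].
by rewrite inE component_notin // component_idem // eqxx.
Qed.

(** The bounds close up: [size s] is at most the number of components, which is at most the number
    of gap starts, at most [size s]. *)
Lemma cut_set_count S (c : 'I_n -> nat) (s : seq 'I_n) :
  2 * r + 2 <= n -> cut_set e S ->  S != finset.set0 ->
  (forall i j, i \notin S -> j \notin S -> e i j -> c i = c j) ->
  all (fun i => i \notin S) s -> uniq (map c s) ->
  #|gap_starts S| <= size s ->
  #|S| = size s * r /\ number_of_components e S = size s.
Proof.
move=> nr cS S0 ce sS us gs.
have le1 := number_of_components_geq ce sS us.
have le2 := number_of_components_leq r_gt0 nr S0.
have ge : #|gap_starts S| = size s by lia.
by split; [rewrite (card_cut_set r_gt0 nr cS) ge | lia].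
Qed.

(** The two blocks on either side of vertex 0 isolate it from the arc from [r + 1] to [n - r - 1];
    the label [c] tells the two apart. *)
Lemma exists_cut_set2 : 2 * r + 2 <= n -> exists2 S, cut_set e S &
  #|S| = 2 * r /\ number_of_components e S = 2.
Proof.
move=> nr; pose S : {set 'I_n} := [set i : 'I_n | (0 < i <= r) || (n - r <= i)].
pose c (i : 'I_n) : nat := 0 < i.
have h0 : 0 < n by lia. have h1 : r.+1 < n by lia. have h2 : n - r - 1 < n by lia.
pose v0 := Ordinal h0; pose v1 := Ordinal h1; pose v2 := Ordinal h2.
have ce i j : i \notin S -> j \notin S -> e i j -> c i = c j.
  rewrite !inE power_cycleE /c; have := ltn_ord i; have := ltn_ord j; lia.
have sep i j : c i != c j -> comp S i != comp S j.
  by apply: contraNneq => /(component_invariant (@power_cycle_sym n r) ce) ->.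
have v0S : v0 \notin S by rewrite inE /=; lia.
have v1S : v1 \notin S by rewrite inE /=; lia.
have v2S : v2 \notin S by rewrite inE /=; lia.
have cS : cut_set e S.
  move=> i; rewrite inE => iS; have ni := ltn_ord i.
  have [ir|ri] := leqP i r.
    exists v0, v1; split; [exact: v0S | exact: v1S | | | by apply: sep; rewrite /c /=; lia];
      rewrite power_cycleE /=; lia.
  exists v0, v2; split; [exact: v0S | exact: v2S | | | by apply: sep; rewrite /c /=; lia];
      rewrite power_cycleE /=; lia.
exists S => //; apply: (@cut_set_count S c [:: v0; v1]) => //=; rewrite ?v0S ?v1S //.
  apply/set0Pn; exists (Ordinal (ltnW h1)) => //; rewrite inE /=; lia.
suff : gap_starts S \subset [set v0; v2].
  by move=> /subset_leq_card /leq_trans; apply; rewrite cards2; case: eqP.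
apply/fintype.subsetP => p; rewrite !inE -!val_eqE val_shift; last lia.
by have := ltn_ord p; case: ifP => /=; lia.
Qed.

(** Three blocks isolate vertices 0 and [r + 1]; the third component is the arc from [2 * r + 2] to
    [n - r - 1], nonempty by the bound on [n]. The labels [c] are 0, 1 and 2. *)
Lemma exists_cut_set3 : 3 * r + 3 <= n -> exists2 S, cut_set e S &
  #|S| = 3 * r /\ number_of_components e S = 3.
Proof.
move=> nr.
pose S : {set 'I_n} :=
  [set i : 'I_n | [|| (0 < i <= r), (r + 2 <= i <= 2 * r + 1) | (n - r <= i)]].
pose c (i : 'I_n) : nat := (0 < i) + (r + 1 < i).
have h0 : 0 < n by lia. have h1 : r.+1 < n by lia. have h2 : 2 * r + 2 < n by lia.
have h3 : n - r - 1 < n by lia.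
pose v0 := Ordinal h0; pose v1 := Ordinal h1; pose v2 := Ordinal h2; pose v3 := Ordinal h3.
have ce i j : i \notin S -> j \notin S -> e i j -> c i = c j.
  rewrite !inE power_cycleE /c; have := ltn_ord i; have := ltn_ord j; lia.
have sep i j : c i != c j -> comp S i != comp S j.
  by apply: contraNneq => /(component_invariant (@power_cycle_sym n r) ce) ->.
have v0S : v0 \notin S by rewrite inE /=; lia.
have v1S : v1 \notin S by rewrite inE /=; lia.
have v2S : v2 \notin S by rewrite inE /=; lia.
have v3S : v3 \notin S by rewrite inE /=; lia.
have c1 : c v1 = 1 by rewrite /c /=; lia.
have c2 : c v2 = 2 by rewrite /c /=; lia.
have cS : cut_set e S.
  move=> i; rewrite inE => iS; have ni := ltn_ord i.
  have [ir|ri] := leqP i r.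
    exists v0, v1; split; [exact: v0S | exact: v1S | | | by apply: sep; rewrite /c /=; lia];
      rewrite power_cycleE /=; lia.
  have [ir2|ri2] := leqP i (2 * r + 1).
    exists v1, v2; split; [exact: v1S | exact: v2S | | | by apply: sep; rewrite /c /=; lia];
      rewrite power_cycleE /=; lia.
  exists v0, v3; split; [exact: v0S | exact: v3S | | | by apply: sep; rewrite /c /=; lia];
      rewrite power_cycleE /=; lia.
exists S => //; apply: (@cut_set_count S c [:: v0; v1; v2]) => //=.
- lia.
- apply/set0Pn; exists (Ordinal (ltnW h1)) => //; rewrite inE /=; lia.
- by rewrite v0S v1S v2S.
- by rewrite c1 c2.
suff : gap_starts S \subset [set v0; v1; v3].
  move=> /subset_leq_card /leq_trans; apply; rewrite finset.setUC cardsU1 cards2.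
  by case: (_ \notin _); case: (_ != _).
apply/fintype.subsetP => p; rewrite !inE -!val_eqE val_shift; last lia.
by have := ltn_ord p; case: ifP => /=; lia.
Qed.

(** A vertex of [S] provides two components, hence two blocks at least. Three blocks would take
    [3 * r] vertices and three gap starts outside them, more than [n]. *)
Lemma cut_set_short_cycle S : 2 * r + 2 <= n <= 3 * r + 2 -> cut_set e S ->
  S != finset.set0 -> #|S| = 2 * r /\ number_of_components e S = 2.
Proof.
move=> /andP[nr nr3] cS S0.
have cardS := card_cut_set r_gt0 nr cS.
have le := number_of_components_leq r_gt0 nr S0.
have gn := card_gap_starts S.
have ge2 : 1 < number_of_components e S.
  have /set0Pn[i iS] := S0; have [a [b [aS bS _ _ ab]]] := cS i iS.
  have es := @power_cycle_sym n r.
  have <- : #|[set comp S a; comp S b]| = 2 by rewrite cards2 ab.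
  apply: subset_leq_card; apply/fintype.subsetP => j; rewrite !inE.
  by case/orP => /eqP ->; rewrite component_notin // component_idem // eqxx.
have g2 : #|gap_starts S| <= 2.
  rewrite leqNgt; apply/negP => g3.
  have : 3 * r <= #|S| by rewrite cardS leq_mul2r g3 orbT.
  have := max_card (mem S); rewrite card_ord.
  nia.
have g2' : #|gap_starts S| = 2 by lia.
by split; [rewrite cardS g2' | lia].
Qed.

End ExplicitCutSets.

Theorem theorem3p12 (m n r : nat) (K : fieldType)
    (hm : 2 <= m) (hr : 1 <= r <= n %/ 2)
    (hG : ~ complete_graph (power_cycle n r)) :
  unmixed (binomial_edge_ideal K m (power_cycle n r)) <->
  [/\ odd m, m + 1 <= n <= (3 * m + 1) %/ 2 & r = (m - 1) %/ 2].
Proof.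
have /andP[r0 _] := hr.
have nr : 2 * r + 2 <= n.
  by rewrite leqNgt; apply/negP => nr; apply: hG; apply: power_cycle_complete; lia.
pose k0 : 'I_m := Ordinal (ltnW hm); pose k1 : 'I_m := Ordinal hm.
have k10 : k1 != k0 by [].
rewrite (unmixed_binomial_edge_ideal K k10 (@power_cycle_sym n r)).
have cut0 : cut_set (power_cycle n r) finset.set0 by move=> i; rewrite inE.
have c0 := number_of_components_empty r0 nr.
have le_mn : m - 1 <= (m - 1) * n by rewrite leq_pmulr //; lia.
split=> [[h hh]|[m_odd mn rm]].
  have := hh _ cut0; rewrite c0 cards0.
  have [S2 cS2 [S2r S2c]] := exists_cut_set2 r0 nr.
  have := hh _ cS2; rewrite S2r S2c => h2 h0.
  (* Passing from no block to two adds one component and [2 * r] vertices, so [m - 1 = 2 * r]. *)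
  have mr : m = 2 * r + 1 by clear -h0 h2 hm; lia.
  (* Three blocks would likewise give [2 * (m - 1) = 3 * r], that is [4 * r = 3 * r]. *)
  have nr3 : n < 3 * r + 3.
    rewrite ltnNge; apply/negP => /(exists_cut_set3 r0) [S3 cS3 [S3r S3c]].
    have := hh _ cS3; rewrite S3r S3c => h3; clear -h0 h2 h3 r0 hm; lia.
  by split; lia.
have mr : m = 2 * r + 1 by lia.
(* The height of the prime of the empty set, whose complement is connected; two blocks give the same
   value as [2 * r = m - 1]. *)
exists ((m - 1) * n - (m - 1)) => S cS.
have [->|S0] := eqVneq S finset.set0.
  by rewrite c0 cards0 muln1 subnK.
have [|-> ->] := cut_set_short_cycle r0 _ cS S0; first lia.
clear -le_mn mr; lia.
Qed.
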